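(* Let $\alpha\ge2$, let $b,\tau$ satisfy condition (U) and let $\sigma$ satisfy condition (S) (i.e. (S1) if $\alpha>2$ and (S2) if $\alpha=2$). Let $(\bar x,\bar p)\in\mathbb{R}^n\times\mathbb{R}^n$, and for $\delta>0$ let $w_\delta=w_\delta(\cdot;\bar x,\bar p)\in C^2(\mathbb{R}^m)$ be the unique bounded solution in $\mathbb{R}^m$ of $$\delta w_\delta-\mathrm{tr}(\tau\tau^T(y)D^2w_\delta)-|\tau(y)^TDw_\delta|^2-b(y)\cdot Dw_\delta-2(\tau(y)\sigma(\bar x,y)^T\bar p)\cdot Dw_\delta-|\sigma(\bar x,y)^T\bar p|^2=0\qquad\text{if }\alpha=2,$$ and of $$\delta w_\delta-\mathrm{tr}(\tau\tau^T(y)D^2w_\delta)-b(y)\cdot Dw_\delta-|\sigma(\bar x,y)^T\bar p|^2=0\qquad\text{if }\alpha>2.$$ Then for all $y,z\in\mathbb{R}^m$ $$|w_\delta(y;\bar x,\bar p)-w_\delta(z;\bar x,\bar p)|\le C|y-z|,$$ where $C$ is a positive constant depending on $\bar x,\bar p,\|\tau\|_\infty,\|\sigma\|_\infty,m$ and the Lipschitz constants of $\tau,b,\sigma$, and independent of $\delta$.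
   Context: Standing assumptions: $\sigma:\mathbb{R}^n\times\mathbb{R}^m\to \mathbf{M}^{n,m}$ (real $n\times m$ matrices) is bounded and Lipschitz continuous in $(x,y)$; $b:\mathbb{R}^m\to\mathbb{R}^m$ is Lipschitz continuous; $\tau:\mathbb{R}^m\to\mathbf{M}^{m,m}$ is bounded, Lipschitz continuous and uniformly non-degenerate: for some $\theta>0$, $|\tau(y)^T\xi|^2>\theta|\xi|^2$ for all $y\in\mathbb{R}^m$ and $\xi\in\mathbb{R}^m\setminus\{0\}$. (U): there exist a vector $b_\infty\in\mathbb{R}^m$, a matrix $\tau_\infty\in\mathbf{M}^{m,m}$ and $R_1$ such that $b(y)=b_\infty-y$ and $\tau(y)=\tau_\infty$ whenever $|y|>R_1$. (S1): for each $x\in\mathbb{R}^n$ there exists $\nu>0$ such that $|\sigma(x,y)^T\xi|^2\ge\nu|\xi|^2$ for all $y\in\mathbb{R}^m$, $\xi\in\mathbb{R}^n$. (S2): for all $x\in\mathbb{R}^n$ there exists $g:\mathbb{R}^m\times\mathbb{R}^m\to\mathbb{R}^+$ such that $\|\sigma(x,y)-\sigma(x,z)\|_\infty\le g(y,z)|y-z|$ for all $y,z\in\mathbb{R}^m$, and for every $\eta>0$ there is $R_\eta>0$ with $g(y,z)\le\eta$ whenever $|y|,|z|\ge R_\eta$. (Here $\|\cdot\|_\infty$ of a matrix is the maximum of the absolute values of its entries; for a matrix-valued function it is the supremum norm.)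
   Formalization: The constant C may also depend on n, on θ, on R_1 and b_∞ from (U), and on the radii R_η from (S2); with only the listed quantities the claim is false, since a bistable drift b with fixed Lipschitz constant and growing R_1 makes the gradient blow up. *)

(* Defs.v *)
(* MathComp-Analysis; R^k is the type 'cV[R]_k of column vectors. *)
From HB Require Import structures.
From mathcomp Require Import all_boot all_order all_algebra.
From mathcomp Require Import all_classical all_reals all_analysis.
Export numFieldNormedType.Exports.
Set Implicit Arguments.
Unset Strict Implicit.
Unset Printing Implicit Defensive.
Import Order.TTheory GRing.Theory Num.Theory.
Local Open Scope classical_set_scope.
Local Open Scope ring_scope.

(* The library norm `|A| of a matrix is the maximum of the absolute values of
   its entries: it is used below for matrices, but the norm of a vector is the
   Euclidean one, enorm. *)
Definition dot (R : realType) (k : nat) (u v : 'cV[R]_k) : R :=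
  \sum_(i < k) u i 0 * v i 0.

Definition enorm (R : realType) (k : nat) (u : 'cV[R]_k) : R :=
  Num.sqrt (dot u u).

Definition partial (R : realType) (k : nat) (i : 'I_k) (f : 'cV[R]_k -> R) :
    'cV[R]_k -> R :=
  fun y => 'D_(delta_mx i 0) f y.

Definition grad (R : realType) (k : nat) (f : 'cV[R]_k -> R) (y : 'cV[R]_k) :
    'cV[R]_k :=
  \col_i partial i f y.

Definition hess (R : realType) (k : nat) (f : 'cV[R]_k -> R) (y : 'cV[R]_k) :
    'M[R]_k :=
  \matrix_(i, j) partial i (partial j f) y.

(* All partial derivatives of order at most 2 exist everywhere and are
   continuous; derivability is stated apart because 'D_v f is total. *)
Definition C2 (R : realType) (k : nat) (f : 'cV[R]_k -> R) : Prop :=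
  [/\ continuous f,
      forall i y, derivable f y (delta_mx i 0),
      forall i, continuous (partial i f),
      forall i j y, derivable (partial j f) y (delta_mx i 0) &
      forall i j, continuous (partial i (partial j f))].

Section Assumptions.
Context (R : realType) (n m : nat).
Implicit Types (sigma : 'cV[R]_n -> 'cV[R]_m -> 'M[R]_(n, m))
  (b : 'cV[R]_m -> 'cV[R]_m) (tau : 'cV[R]_m -> 'M[R]_m).

(* Boundedness of sigma by M and Lipschitz continuity, with constant L, for
   the Euclidean norm of R^(n + m). *)
Definition sigma_std sigma (M L : R) : Prop :=
  (forall x y, `|sigma x y| <= M) /\
  (forall x x' y y', `|sigma x y - sigma x' y'|
     <= L * enorm (col_mx (x - x') (y - y'))).

Definition b_std b (L : R) : Prop :=
  forall y z, enorm (b y - b z) <= L * enorm (y - z).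

Definition tau_std tau (M L theta : R) : Prop :=
  [/\ forall y, `|tau y| <= M,
      forall y z, `|tau y - tau z| <= L * enorm (y - z) &
      forall y (xi : 'cV[R]_m), xi != 0 ->
        theta * enorm xi ^+ 2 < enorm ((tau y)^T *m xi) ^+ 2].

Definition condU b tau (binf : 'cV[R]_m) (tauinf : 'M[R]_m) (R1 : R) : Prop :=
  forall y, R1 < enorm y -> b y = binf - y /\ tau y = tauinf.

Definition condS1 sigma : Prop :=
  forall x, exists2 nu : R, 0 < nu &
    forall y (xi : 'cV[R]_n),
      nu * enorm xi ^+ 2 <= enorm ((sigma x y)^T *m xi) ^+ 2.

(* rad x eta is the radius R_eta associated with x. *)
Definition condS2 sigma (rad : 'cV[R]_n -> R -> R) : Prop :=
  forall x, exists g : 'cV[R]_m -> 'cV[R]_m -> R,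
    [/\ forall y z, 0 <= g y z,
        forall y z, `|sigma x y - sigma x z| <= g y z * enorm (y - z) &
        forall eta, 0 < eta -> 0 < rad x eta /\
          forall y z, rad x eta <= enorm y -> rad x eta <= enorm z ->
            g y z <= eta].

Definition condS (alpha : R) sigma (rad : 'cV[R]_n -> R -> R) : Prop :=
  (2 < alpha -> condS1 sigma) /\ (alpha = 2 -> condS2 sigma rad).

Definition cell_eq_critical sigma b tau (x p : 'cV[R]_n) (delta : R)
    (w : 'cV[R]_m -> R) : Prop :=
  forall y,
    delta * w y - \tr (tau y *m (tau y)^T *m hess w y)
    - enorm ((tau y)^T *m grad w y) ^+ 2
    - dot (b y) (grad w y)
    - 2 * dot (tau y *m (sigma x y)^T *m p) (grad w y)
    - enorm ((sigma x y)^T *m p) ^+ 2 = 0.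

Definition cell_eq_supercritical sigma b tau (x p : 'cV[R]_n) (delta : R)
    (w : 'cV[R]_m -> R) : Prop :=
  forall y,
    delta * w y - \tr (tau y *m (tau y)^T *m hess w y)
    - dot (b y) (grad w y)
    - enorm ((sigma x y)^T *m p) ^+ 2 = 0.

Definition cell_eq (alpha : R) sigma b tau (x p : 'cV[R]_n) (delta : R)
    (w : 'cV[R]_m -> R) : Prop :=
  (alpha = 2 -> cell_eq_critical sigma b tau x p delta w) /\
  (2 < alpha -> cell_eq_supercritical sigma b tau x p delta w).

End Assumptions.

(* Main.v *)
Require Import Defs.
From mathcomp Require Import all_boot all_order all_algebra.
From mathcomp Require Import all_classical all_reals all_analysis.
From mathcomp Require Import ring lra.
Set Implicit Arguments.
Unset Strict Implicit.
Unset Printing Implicit Defensive.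
Import Order.TTheory GRing.Theory Num.Theory.
Local Open Scope classical_set_scope.
Local Open Scope ring_scope.

(** Both equations are handled by doubling the variables.  If
    [w y - w z <= phi |y - z|] fails for some increasing profile [phi], then after a
    vanishing penalization at infinity [w y - w z - phi |y - z|] has a positive
    maximum off the diagonal ([doubling]).  There both gradients equal [phi'] times
    the unit vector joining the points, and the second-order parts are compared
    along any coupling of the two diffusions ([two_point_max]).  Reflecting one of
    them at short range, and taking them independent otherwise, makes [phi''] act
    with the full ellipticity constant at a cost bounded by a multiple of [phi']
    ([coupling]).  The discount [delta] only contributes
    [delta * (w y - w z) >= 0], which is why it does not enter the constant.

    In the linear equation the source is bounded, and the drift is a bounded
    perturbation of [binf - y], so it contracts the distance [r] at a rate
    [r - const].  A concave profile, exponential plus linear, is then a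
    supersolution of the one-dimensional inequality at all distances, and it is
    Lipschitz ([linear_equation_lipschitz]).

    With the quadratic gradient term such a profile need not exist: at
    intermediate distances the square of [phi'] can force [phi'] to vanish in finite
    length.  There the gradient is first bounded on balls.  The function
    [exp w] is a positive solution of a linear equation whose zero-order
    coefficient [delta w - |s|^2], with [s] the vector [sigma^T p], is bounded
    ([critical_equation_sup]), so a Harnack inequality together with an interior
    Lipschitz estimate bounds its logarithmic gradient ([log_gradient_bound]).
    The Harnack inequality is elementary here, because the interior
    estimate ([interior_lipschitz], again doubling) keeps the solution large on a
    whole ball around a weighted maximum point, and a power barrier propagates that
    lower bound ([harnack]).  Globally the doubling is done with a linear profile
    of slope [C] larger than the bound on a big ball: both maximum points must then
    lie outside this ball, where the diffusion is constant, the drift contracts at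
    unit rate, and [s] has an arbitrarily small Lipschitz constant, so that the
    quadratic terms cannot balance the contraction
    ([critical_equation_lipschitz]). *)

(** * Euclidean vectors and matrices *)

Section Euclidean.
Context {R : realType}.

Lemma dotE k (u v : 'cV[R]_k) : dot u v = (u^T *m v) 0 0.
Proof. by rewrite mxE; apply: eq_bigr => i _; rewrite mxE. Qed.

Lemma dotC k (u v : 'cV[R]_k) : dot u v = dot v u.
Proof. by apply: eq_bigr => i _; rewrite mulrC. Qed.

Lemma dotDl k (u v w : 'cV[R]_k) : dot (u + v) w = dot u w + dot v w.
Proof. by rewrite !dotE linearD mulmxDl mxE. Qed.

Lemma dotDr k (u v w : 'cV[R]_k) : dot u (v + w) = dot u v + dot u w.
Proof. by rewrite !(dotC u) dotDl. Qed.

Lemma dotZl k a (u v : 'cV[R]_k) : dot (a *: u) v = a * dot u v.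
Proof. by rewrite !dotE linearZ -scalemxAl mxE. Qed.

Lemma dotZr k a (u v : 'cV[R]_k) : dot u (a *: v) = a * dot u v.
Proof. by rewrite !(dotC u) dotZl. Qed.

Lemma dotNl k (u v : 'cV[R]_k) : dot (- u) v = - dot u v.
Proof. by rewrite -scaleN1r dotZl mulN1r. Qed.

Lemma dotNr k (u v : 'cV[R]_k) : dot u (- v) = - dot u v.
Proof. by rewrite !(dotC u) dotNl. Qed.

Lemma dotBl k (u v w : 'cV[R]_k) : dot (u - v) w = dot u w - dot v w.
Proof. by rewrite dotDl dotNl. Qed.

Lemma dotBr k (u v w : 'cV[R]_k) : dot u (v - w) = dot u v - dot u w.
Proof. by rewrite dotDr dotNr. Qed.

Lemma dot0l k (u : 'cV[R]_k) : dot 0 u = 0.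
Proof. by rewrite -(scale0r u) dotZl mul0r. Qed.

Lemma dot0r k (u : 'cV[R]_k) : dot u 0 = 0.
Proof. by rewrite dotC dot0l. Qed.

Lemma dot_mull k l (A : 'M[R]_(k, l)) u v : dot (A *m u) v = dot u (A^T *m v).
Proof. by rewrite !dotE trmx_mul mulmxA. Qed.

Lemma dot_mulr k l (A : 'M[R]_(k, l)) u v : dot u (A *m v) = dot (A^T *m u) v.
Proof. by rewrite dot_mull trmxK. Qed.

Definition dotDE := (dotDl, dotDr, dotNl, dotNr, dotZl, dotZr, dot0l, dot0r).

Lemma dot_ge0 k (u : 'cV[R]_k) : 0 <= dot u u.
Proof. by apply: sumr_ge0 => i _; rewrite -expr2 sqr_ge0. Qed.

Lemma enorm_ge0 k (u : 'cV[R]_k) : 0 <= enorm u.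
Proof. exact: sqrtr_ge0. Qed.

Lemma enorm_sqr k (u : 'cV[R]_k) : enorm u ^+ 2 = dot u u.
Proof. by rewrite sqr_sqrtr // dot_ge0. Qed.

Lemma coord_le_enorm k (u : 'cV[R]_k) i : `|u i 0| <= enorm u.
Proof.
rewrite -(ler_pXn2r (n := 2)) ?nnegrE ?enorm_ge0 // enorm_sqr real_normK ?num_real //.
rewrite /dot (bigD1 i) //= expr2 lerDl.
by apply: sumr_ge0 => j _; rewrite -expr2 sqr_ge0.
Qed.

Lemma enorm_eq0 k (u : 'cV[R]_k) : enorm u = 0 -> u = 0.
Proof.
move=> u0; apply/matrixP => i j; rewrite ord1 mxE; apply/eqP.
by rewrite -normr_le0 -u0 coord_le_enorm.
Qed.

Lemma enorm0 k : enorm (0 : 'cV[R]_k) = 0.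
Proof. by rewrite /enorm dot0l sqrtr0. Qed.

Lemma enorm_gt0 k (u : 'cV[R]_k) : (0 < enorm u) = (u != 0).
Proof.
rewrite lt_neqAle enorm_ge0 andbT eq_sym; congr negb.
by apply/eqP/eqP => [/enorm_eq0|->//]; rewrite ?enorm0.
Qed.

Lemma enormZ k a (u : 'cV[R]_k) : enorm (a *: u) = `|a| * enorm u.
Proof. by rewrite /enorm dotZl dotZr mulrA -expr2 sqrtrM ?sqr_ge0 // sqrtr_sqr. Qed.

Lemma enormN k (u : 'cV[R]_k) : enorm (- u) = enorm u.
Proof. by rewrite -scaleN1r enormZ normrN1 mul1r. Qed.

Lemma enormC k (u v : 'cV[R]_k) : enorm (u - v) = enorm (v - u).
Proof. by rewrite -enormN opprB. Qed.

(** Cauchy-Schwarz, from the non-negativity of the square of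
    [|v| u - |u| v]. *)
Lemma dot_le k (u v : 'cV[R]_k) : dot u v <= enorm u * enorm v.
Proof.
have [->|v0] := eqVneq v 0; first by rewrite dot0r enorm0 mulr0.
have [->|u0] := eqVneq u 0; first by rewrite dot0l enorm0 mul0r.
have := dot_ge0 (enorm v *: u - enorm u *: v).
rewrite !dotDE -!enorm_sqr (dotC v u).
move: u0 v0; rewrite -!enorm_gt0 => u0 v0 h.
have : 0 <= 2 * (enorm u * enorm v) * (enorm u * enorm v - dot u v) by lra.
by rewrite pmulr_rge0 ?subr_ge0 // !mulr_gt0.
Qed.

Lemma normr_dot_le k (u v : 'cV[R]_k) : `|dot u v| <= enorm u * enorm v.
Proof.
by rewrite ler_norml dot_le andbT lerNl -dotNl -(enormN u) dot_le.
Qed.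

Lemma enormD k (u v : 'cV[R]_k) : enorm (u + v) <= enorm u + enorm v.
Proof.
rewrite -(ler_pXn2r (n := 2)) ?nnegrE ?addr_ge0 ?enorm_ge0 //.
rewrite enorm_sqr !dotDE (dotC v u) -!enorm_sqr.
by have := dot_le u v; lra.
Qed.

Lemma enormB k (u v : 'cV[R]_k) : enorm (u - v) <= enorm u + enorm v.
Proof. by rewrite -(enormN v) enormD. Qed.

Lemma enorm_sub_le k (u v : 'cV[R]_k) : enorm u - enorm v <= enorm (u - v).
Proof. by rewrite lerBlDr -{1}(subrK v u) enormD. Qed.

Lemma normmx_coord k l (A : 'M[R]_(k, l)) i j : `|A i j| <= `|A|.
Proof.
rewrite [leRHS]/Num.Def.normr /= mx_normrE.
by apply/bigmax_geP; right => /=; exists (i, j).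
Qed.

(** The squared Frobenius norm, written as a trace so that it meets the
    second-order part of the operator by plain matrix algebra. *)
Definition fro2 k l (A : 'M[R]_(k, l)) : R := \tr (A *m A^T).

Lemma fro2E k l (A : 'M[R]_(k, l)) : fro2 A = \sum_i \sum_j A i j ^+ 2.
Proof.
by apply: eq_bigr => i _; rewrite mxE; apply: eq_bigr => j _; rewrite mxE expr2.
Qed.

Lemma fro2_ge0 k l (A : 'M[R]_(k, l)) : 0 <= fro2 A.
Proof. by rewrite fro2E; do 2 apply: sumr_ge0 => ? _; rewrite sqr_ge0. Qed.

Lemma fro2_le k l (A : 'M[R]_(k, l)) M :
  `|A| <= M -> fro2 A <= (k * l)%:R * M ^+ 2.
Proof.
move=> AM; rewrite fro2E.
apply: (@le_trans _ _ (\sum_(i < k) \sum_(j < l) M ^+ 2)).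
  do 2 apply: ler_sum => ? _; rewrite -real_normK ?num_real //.
  have M0 : 0 <= M by apply: le_trans AM.
  by rewrite ler_pXn2r ?nnegrE // (le_trans (normmx_coord _ _ _) AM).
by rewrite !sumr_const !card_ord -mulrnA mulr_natl mulnC.
Qed.

Lemma enorm_mul_sqr_le k l (A : 'M[R]_(k, l)) u :
  enorm (A *m u) ^+ 2 <= fro2 A * enorm u ^+ 2.
Proof.
rewrite enorm_sqr fro2E mulr_suml; apply: ler_sum => i _.
have -> : (A *m u) i 0 = dot (row i A)^T u.
  by rewrite mxE; apply: eq_bigr => j _; rewrite !mxE.
rewrite -expr2 -real_normK ?num_real //.
apply: (@le_trans _ _ ((enorm (row i A)^T * enorm u) ^+ 2)).
  by rewrite ler_pXn2r ?nnegrE ?mulr_ge0 ?enorm_ge0 ?normr_dot_le.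
rewrite exprMn [X in X * _]enorm_sqr; apply: ler_wpM2r; first exact: sqr_ge0.
by apply: ler_sum => j _; rewrite !mxE expr2.
Qed.

Lemma fro2_tr k l (A : 'M[R]_(k, l)) : fro2 A^T = fro2 A.
Proof. by rewrite /fro2 trmxK mxtrace_mulC. Qed.

Lemma enorm_mul_le k l (A : 'M[R]_(k, l)) u :
  enorm (A *m u) <= Num.sqrt (fro2 A) * enorm u.
Proof.
rewrite -(ler_pXn2r (n := 2)) ?nnegrE ?mulr_ge0 ?sqrtr_ge0 ?enorm_ge0 //.
by rewrite exprMn (sqr_sqrtr (fro2_ge0 A)) enorm_mul_sqr_le.
Qed.

Lemma mxtrace_cols k l (A : 'M[R]_(k, l)) (X : 'M[R]_k) :
  \tr (A *m A^T *m X) = \sum_j dot (col j A) (X *m col j A).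
Proof.
rewrite -mulmxA mxtrace_mulC; apply: eq_bigr => j _.
rewrite dotE tr_col -mulmxA !mxE; apply: eq_bigr => i _; rewrite !mxE.
by congr (_ * _); apply: eq_bigr => i' _; rewrite !mxE.
Qed.

Lemma fro2_cols k l (A : 'M[R]_(k, l)) :
  fro2 A = \sum_j dot (col j A) (col j A).
Proof.
by rewrite -[fro2 A]/(\tr _) -(mulmx1 (A *m A^T)) mxtrace_cols; under eq_bigr do rewrite mul1mx.
Qed.

Lemma enorm_tr_cols k l (A : 'M[R]_(k, l)) (e : 'cV[R]_k) :
  enorm (A^T *m e) ^+ 2 = \sum_j dot e (col j A) ^+ 2.
Proof.
rewrite enorm_sqr; apply: eq_bigr => j _; rewrite -expr2; congr (_ ^+ 2).
by rewrite mxE; apply: eq_bigr => i _; rewrite !mxE mulrC.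
Qed.

Lemma enorm_continuous k : continuous (@enorm R k).
Proof.
move=> u; apply: (@continuous_comp _ _ _ (fun u => dot u u) Num.sqrt).
  apply: (@continuous_big R _ +%R 0 xpredT) => [|i _ v].
    exact: add_continuous.
  have vi := @coord_continuous R k 1 i 0 v.
  exact: (@continuousM R _ _ _ v vi vi).
exact: sqrt_continuous.
Qed.

Lemma enorm_subl_continuous k (c : 'cV[R]_k) :
  continuous (fun y : 'cV[R]_k => enorm (y - c)).
Proof.
move=> y; apply: (@continuous_comp _ _ _ (fun y : 'cV[R]_k => y - c)).
  apply: (@cvgD R 'cV[R]_k 'cV[R]_k (nbhs y) _ id (cst (- c)) y (- c)) => //.
  exact: cvg_cst.
exact: enorm_continuous.
Qed.

Lemma enorm_sub_continuous k :
  continuous (fun p : 'cV[R]_k * 'cV[R]_k => enorm (p.1 - p.2)).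
Proof.
move=> p; apply: (@continuous_comp _ _ _ (fun p : 'cV[R]_k * 'cV[R]_k => p.1 - p.2)).
  apply: (@cvgB R 'cV[R]_k _ (nbhs p) _ fst snd p.1 p.2).
    exact: cvg_fst.
  exact: cvg_snd.
exact: enorm_continuous.
Qed.

Lemma compact_eball k (c : 'cV[R]_k) rho : compact [set y | enorm (y - c) <= rho].
Proof.
have cl : closed [set y | enorm (y - c) <= rho].
  have cont := @enorm_subl_continuous k c.
  exact: (continuous_closedP _).1 cont _ (@closed_le R rho).
pose A := [set v : 'rV[R]_k | enorm (v^T - c) <= rho].
have trc p q : continuous (@trmx R p q).
  move=> M s /= /(nbhs_ballP (M^T)) [e e0 es].
  apply/nbhs_ballP; exists e => //= N MN; apply: es; case: MN => _ MN.
  by split => // i j; rewrite !mxE; apply: MN.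
have -> : [set y | enorm (y - c) <= rho] = trmx @` A.
  apply/seteqP; split => [y /= yc|_ [v /= vA <-]] //.
  by exists y^T; rewrite /A /= ?trmxK.
apply: continuous_compact.
  by move=> x; apply: continuous_subspaceT; exact: trc.
apply: bounded_closed_compact; last first.
  exact: (continuous_closedP _).1 (trc _ _) _ cl.
exists (enorm c + `|rho|); split; first exact: num_real.
move=> x hx v /= vA; apply: le_trans (ltW hx).
rewrite [leLHS]/Num.Def.normr /= mx_normrE; apply: bigmax_le => [|[i j] _ /=].
  by rewrite addr_ge0 // enorm_ge0.
have -> : v i j = (v^T - c) j 0 + c j 0 by rewrite !mxE subrK ord1.
apply: le_trans (ler_normD _ _) _; rewrite addrC lerD ?coord_le_enorm //.
by apply: le_trans (coord_le_enorm _ _) _; apply: le_trans vA _; rewrite ler_norm.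
Qed.

End Euclidean.

(** * Second-order expansions along lines *)

Section Expansions.
Context {R : realType}.
Implicit Types (g : R -> R) (a b c : R).

(** Peano expansion of order two at the origin, with [c] half the second
    derivative when there is one; the value [t = 0] forces [g 0 = a]. *)
Definition expands2 g a b c := forall eps : R, 0 < eps ->
  exists2 d : R, 0 < d & forall t : R, `|t| < d -> `|g t - (a + b * t + c * t ^+ 2)| <= eps * t ^+ 2.

Lemma expands2_0 g a b c : expands2 g a b c -> g 0 = a.
Proof.
move=> /(_ 1 ltr01)[d d0 /(_ 0)]; rewrite normr0 => /(_ d0).
rewrite expr0n /= !mulr0 !addr0 normr_le0 subr_eq0.
by move/eqP.
Qed.

Lemma expands2_poly g a b c :
  (forall t, g t = a + b * t + c * t ^+ 2) -> expands2 g a b c.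
Proof.
move=> gE eps eps0; exists 1 => // t _.
by rewrite gE subrr normr0 mulr_ge0 ?sqr_ge0 // ltW.
Qed.

Lemma expands2_eq g g' a a' b b' c c' :
  g =1 g' -> a = a' -> b = b' -> c = c' -> expands2 g a b c -> expands2 g' a' b' c'.
Proof.
move=> gg <- <- <- h eps eps0; have [d d0 hd] := h eps eps0.
by exists d => // t td; rewrite -gg hd.
Qed.

Lemma expands2D g g' a a' b b' c c' :
  expands2 g a b c -> expands2 g' a' b' c' ->
  expands2 (fun t => g t + g' t) (a + a') (b + b') (c + c').
Proof.
move=> h h' eps eps0; have e2 : 0 < eps / 2 by rewrite divr_gt0.
have [d d0 hd] := h _ e2; have [d' d'0 hd'] := h' _ e2.
exists (Num.min d d'); first by rewrite lt_min d0.
move=> t; rewrite lt_min => /andP[/hd {}hd /hd' {}hd'].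
have -> : g t + g' t - (a + a' + (b + b') * t + (c + c') * t ^+ 2) =
  (g t - (a + b * t + c * t ^+ 2)) + (g' t - (a' + b' * t + c' * t ^+ 2)) by ring.
by apply: le_trans (ler_normD _ _) _; lra.
Qed.

Lemma expands2Z k g a b c :
  expands2 g a b c -> expands2 (fun t => k * g t) (k * a) (k * b) (k * c).
Proof.
move=> h eps eps0; have k0 : 0 < `|k| + 1 by rewrite ltr_wpDl.
have [d d0 hd] := h _ (divr_gt0 eps0 k0).
exists d => // t /hd {}hd.
have -> : k * g t - (k * a + k * b * t + k * c * t ^+ 2) =
  k * (g t - (a + b * t + c * t ^+ 2)) by ring.
rewrite normrM; apply: le_trans (ler_wpM2l (normr_ge0 k) hd) _.
rewrite mulrA ler_wpM2r ?sqr_ge0 // mulrCA ler_piMr ?(ltW eps0) //.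
by rewrite ler_pdivrMr // mul1r lerDl.
Qed.

Lemma expands2N g a b c :
  expands2 g a b c -> expands2 (fun t => - g t) (- a) (- b) (- c).
Proof.
move=> /(expands2Z (-1)); apply: expands2_eq => [t|||]; rewrite mulN1r //.
Qed.

Lemma expands2B g g' a a' b b' c c' :
  expands2 g a b c -> expands2 g' a' b' c' ->
  expands2 (fun t => g t - g' t) (a - a') (b - b') (c - c').
Proof. by move=> h /expands2N; exact: expands2D. Qed.

Lemma expands2_max g a b c :
  expands2 g a b c -> (exists2 d : R, 0 < d & forall t : R, `|t| < d -> g t <= g 0) ->
  b = 0 /\ c <= 0.
Proof.
move=> h [d d0 gmax].
have ga := expands2_0 h.
have key (eps : R) : 0 < eps -> exists2 d' : R, 0 < d' &
    forall t : R, `|t| < d' -> b * t + c * t ^+ 2 <= eps * t ^+ 2.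
  move=> /h[d' d'0 hd']; exists (Num.min d d'); first by rewrite lt_min d0.
  move=> t; rewrite lt_min => /andP[/gmax gt /hd'].
  by rewrite ler_norml => /andP[+ _]; rewrite ga in gt; lra.
have b0 : b = 0.
  apply/eqP; apply: contraT => bn0.
  have [d' d'0 hd'] := key 1 ltr01.
  (* at this distance the linear term dominates the two quadratic ones *)
  pose s := Num.min (d' / 2) (`|b| / 2 / (`|c| + 1)).
  have c1 : 0 < `|c| + 1 by rewrite ltr_wpDl.
  have s0 : 0 < s by rewrite lt_min !divr_gt0 // normr_gt0.
  have sd : s < d' by rewrite gt_min; apply/orP; left; lra.
  have sb : s * (`|c| + 1) <= `|b| / 2.
    by rewrite -ler_pdivlMr // ge_min lexx orbT.
  have := hd' (Num.sg b * s).
  rewrite normrM normr_sg bn0 /= !mul1r gtr0_norm // => /(_ sd).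
  rewrite exprMn sqr_sg bn0 /= ?mul1r mulrA [b * _]mulrC -normrEsg.
  have cl : - `|c| <= c by rewrite lerNl -normrN ler_norm.
  have cs : - `|c| * s ^+ 2 <= c * s ^+ 2 by rewrite ler_wpM2r ?sqr_ge0.
  have sbs : s * (`|c| + 1) * s <= `|b| / 2 * s := ler_wpM2r (ltW s0) sb.
  have : 0 < `|b| * s by rewrite mulr_gt0 ?normr_gt0.
  lra.
split=> //; rewrite leNgt; apply/negP => c0.
have [d' d'0 hd'] := key (c / 2) (divr_gt0 c0 (ltr0Sn _ 1)).
have := hd' (d' / 2); rewrite gtr0_norm ?divr_gt0 // => /(_ _).
have /[swap] /[apply] : d' / 2 < d' by lra.
have : 0 < c * (d' / 2) ^+ 2 by rewrite mulr_gt0 // exprn_gt0 // divr_gt0.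
by rewrite b0; lra.
Qed.

(** The remainder stays quadratic because the inner increment is [O(t)]. *)
Lemma expands2_comp g F a b c f1 f2 :
  expands2 g a b c -> forall f0, expands2 (fun s => F (a + s)) f0 f1 f2 ->
  expands2 (F \o g) f0 (f1 * b) (f1 * c + f2 * b ^+ 2).
Proof.
move=> hg f0 hF eps eps0.
pose M : R := `|b| + `|c| + 1.
have M0 : 0 < M by rewrite /M ltr_wpDl // addr_ge0.
pose e1 := eps / 3 / M ^+ 2.
have M20 : 0 < M ^+ 2 by rewrite exprn_gt0.
have e10 : 0 < e1 by rewrite /e1 !divr_gt0.
pose e2 := eps / 3 / (`|f1| + 1).
have f10 : 0 < `|f1| + 1 by rewrite ltr_wpDl.
have e20 : 0 < e2 by rewrite /e2 !divr_gt0.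
have [d1 d10 h1] := hF _ e10.
have [d2 d20 h2] := hg _ e20.
have [d3 d30 h3] := hg _ ltr01.
pose N : R := `|f2| * (`|c| + 1) * (M + `|b|) + 1.
have N0 : 0 < N by rewrite /N ltr_wpDl // !mulr_ge0 // addr_ge0 // ltW.
exists (Num.min (Num.min 1 (d1 / M)) (Num.min (Num.min d2 d3) (eps / 3 / N))).
  by rewrite !lt_min ltr01 !divr_gt0 //= d20 d30.
move=> t; rewrite !lt_min => /andP[/andP[t1 tM] /andP[/andP[t2 t3] tN]].
pose s := g t - a.
have tt : t ^+ 2 = `|t| * `|t| by rewrite -expr2 real_normK ?num_real.
have t0 : 0 <= `|t| := normr_ge0 t.
have tt0 : 0 <= t ^+ 2 := sqr_ge0 t.
have ttt : t ^+ 2 <= `|t| by rewrite tt ler_piMl // ltW.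
have sb : `|s - b * t| <= (`|c| + 1) * t ^+ 2.
  have -> : s - b * t = (g t - (a + b * t + c * t ^+ 2)) + c * t ^+ 2 by rewrite /s; ring.
  apply: le_trans (ler_normD _ _) _; rewrite normrM (ger0_norm tt0).
  by have := h3 _ t3; lra.
have sM : `|s| <= M * `|t|.
  rewrite -(subrK (b * t) s); apply: le_trans (ler_normD _ _) _.
  have h : (`|c| + 1) * t ^+ 2 <= (`|c| + 1) * `|t| by rewrite ler_wpM2l // addr_ge0.
  by rewrite normrM /M; lra.
have sd : `|s| < d1 by apply: le_lt_trans sM _; rewrite mulrC -ltr_pdivlMr.
have {}h1 := h1 _ sd; have {}h2 := h2 _ t2.
rewrite /= {1}(_ : g t = a + s); last by rewrite /s; ring.
have -> : F (a + s) - (f0 + f1 * b * t + (f1 * c + f2 * b ^+ 2) * t ^+ 2) =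
   (F (a + s) - (f0 + f1 * s + f2 * s ^+ 2)) +
   f1 * (g t - (a + b * t + c * t ^+ 2)) +
   f2 * ((s - b * t) * (s + b * t)) by rewrite /s; ring.
have -> : eps * t ^+ 2 = eps / 3 * t ^+ 2 + eps / 3 * t ^+ 2 + eps / 3 * t ^+ 2 by field.
apply: le_trans (ler_normD _ _) _; apply: lerD.
  apply: le_trans (ler_normD _ _) _; apply: lerD.
    apply: le_trans h1 _.
    apply: (@le_trans _ _ (e1 * (M * `|t|) ^+ 2)).
      rewrite ler_wpM2l ?(ltW e10) // -[s ^+ 2]real_normK ?num_real //.
      by rewrite ler_pXn2r ?nnegrE // mulr_ge0 // ltW.
    rewrite exprMn mulrA real_normK ?num_real // /e1 divfK ?gt_eqF //.
  rewrite normrM; apply: le_trans (ler_wpM2l (normr_ge0 _) h2) _.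
  rewrite mulrA ler_wpM2r // /e2 mulrCA ler_piMr ?divr_ge0 ?(ltW eps0) //.
  by rewrite ler_pdivrMr // mul1r lerDl.
rewrite !normrM.
have sb2 : `|s + b * t| <= (M + `|b|) * `|t|.
  by apply: le_trans (ler_normD _ _) _; rewrite normrM; lra.
have e3 : N * `|t| <= eps / 3 by rewrite mulrC -ler_pdivlMr // ltW.
apply: (@le_trans _ _ (`|f2| * ((`|c| + 1) * t ^+ 2 * ((M + `|b|) * `|t|)))).
  by rewrite ler_wpM2l // ler_pM.
apply: (@le_trans _ _ (N * `|t| * t ^+ 2)); last by rewrite ler_wpM2r.
rewrite /N; have := mulr_ge0 t0 tt0; lra.
Qed.

Lemma expands2_sqr g (a b c : R) : expands2 g a b c ->
  expands2 (fun t => g t * g t) (a * a) (2 * a * b) (2 * a * c + b ^+ 2).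
Proof.
move=> h.
have hs : expands2 (fun s => (a + s) * (a + s)) (a * a) (2 * a) 1.
  by apply: expands2_poly => t; ring.
by apply: expands2_eq (expands2_comp (F := fun x => x * x) h hs) => //; ring.
Qed.

(** Polarization reduces the product to squares, hence to composition. *)
Lemma expands2M g g' (a a' b b' c c' : R) :
  expands2 g a b c -> expands2 g' a' b' c' ->
  expands2 (fun t => g t * g' t) (a * a') (a * b' + a' * b)
    (a * c' + b * b' + a' * c).
Proof.
move=> h h'.
have hp := expands2Z (1 / 4) (expands2_sqr (expands2D h h')).
have hm := expands2Z (1 / 4) (expands2_sqr (expands2B h h')).
by apply: expands2_eq (expands2B hp hm) => [t|||]; field.
Qed.

Lemma expands2V (a : R) : 0 < a ->
  expands2 (fun s => (a + s)^-1) a^-1 (- a^-1 ^+ 2) (a^-1 ^+ 3).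
Proof.
move=> a0 eps eps0.
have a4 : 0 < eps * a ^+ 4 / 2 by rewrite divr_gt0 // mulr_gt0 // exprn_gt0.
exists (Num.min (a / 2) (eps * a ^+ 4 / 2)); first by rewrite lt_min a4 divr_gt0.
move=> t; rewrite lt_min => /andP[ta te].
have ha : a / 2 <= a + t by move: ta; rewrite ltr_norml => /andP[]; lra.
have at0 : 0 < a + t by apply: lt_le_trans ha; rewrite divr_gt0.
have -> : (a + t)^-1 - (a^-1 + - a^-1 ^+ 2 * t + a^-1 ^+ 3 * t ^+ 2) =
    - t / (a ^+ 3 * (a + t)) * t ^+ 2.
  by field; rewrite !gt_eqF.
rewrite normrM (ger0_norm (sqr_ge0 t)) ler_wpM2r ?sqr_ge0 //.
have p0 : 0 < a ^+ 3 * (a + t) by rewrite mulr_gt0 // exprn_gt0.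
rewrite normrM normfV (gtr0_norm p0) normrN ler_pdivrMr //.
apply: (le_trans (ltW te)).
have -> : eps * a ^+ 4 / 2 = eps * (a ^+ 3 * (a / 2)) by field.
by rewrite ler_wpM2l ?(ltW eps0) // ler_wpM2l // exprn_ge0 // ltW.
Qed.

Lemma expands2_powV (a : R) j : 0 < a ->
  expands2 (fun s => (a + s)^-1 ^+ j) (a^-1 ^+ j)
    (- (j%:R * a^-1 ^+ j.+1)) (j%:R * j.+1%:R / 2 * a^-1 ^+ j.+2).
Proof.
move=> a0; elim: j => [|j ih].
  by apply: expands2_poly => t; rewrite !expr0 !mul0r; ring.
apply: expands2_eq (expands2M (expands2V a0) ih) => [t|||].
- by rewrite exprS.
- by rewrite exprS.
- by rewrite -!natr1 !exprS; ring.
- by rewrite -!natr1 !exprS; field; rewrite gt_eqF.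
Qed.

Lemma expands2_slope g (a b c d M : R) : expands2 g a b c -> 0 < d ->
  (forall t, 0 < t < d -> a - g t <= M * t) -> - b <= M.
Proof.
move=> h d0 hM; have [d' d'0 hd'] := h _ ltr01.
rewrite leNgt; apply/negP => Mb.
have c0 : 0 < `|c| + 1 by rewrite ltr_wpDl.
pose mn : R := Num.min (Num.min d d') ((- b - M) / (`|c| + 1)).
have gap0 : 0 < - b - M by rewrite subr_gt0.
have mn0 : 0 < mn by rewrite !lt_min d0 d'0 divr_gt0.
have mnd : mn <= d by rewrite !ge_min lexx.
have mnd' : mn <= d' by rewrite !ge_min lexx orbT.
have mnc : mn * (`|c| + 1) <= - b - M.
  by rewrite -ler_pdivlMr // !ge_min lexx orbT.
pose t := mn / 2; have t0 : 0 < t by rewrite divr_gt0.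
have td : t < d by rewrite /t; clear - mn0 mnd; lra.
have td' : `|t| < d' by rewrite gtr0_norm // /t; clear - mn0 mnd'; lra.
have tc : t * (`|c| + 1) < - b - M by rewrite /t; clear - gap0 mnc; lra.
have tt : 0 < t < d by rewrite t0.
have h1 := hM _ tt; have := hd' _ td'; rewrite ler_norml => /andP[_ h2].
have h3 : t * (t * (`|c| + 1)) < t * (- b - M) by rewrite ltr_pM2l.
have h4 : c * t ^+ 2 <= `|c| * t ^+ 2 by rewrite ler_wpM2r ?sqr_ge0 ?ler_norm.
by clear - h1 h2 h3 h4; lra.
Qed.

Lemma is_deriveP (V : normedModType R) (f : V -> R) (x v : V) (df : R) :
  is_derive x v f df <-> forall eps : R, 0 < eps ->
    exists2 d : R, 0 < d & forall t : R, `|t| < d -> `|f (x + t *: v) - f x - t * df| <= eps * `|t|.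
Proof.
split=> [fdf|h].
  move=> eps eps0; have [dv dE] := fdf.
  have : (fun h => h^-1 *: (f (h *: v + x) - f x)) @ 0^' --> df by rewrite -dE.
  move/cvgrPdist_le => /(_ _ eps0); rewrite near_withinE /= => /nbhs_ballP[d /= d0 hd].
  exists d => // t td; have [->|t0] := eqVneq t 0.
    by rewrite scale0r addr0 subrr mul0r subr0 normr0 mulr0.
  have {}hd : `|df - t^-1 *: (f (t *: v + x) - f x)| <= eps.
    by apply: hd => //; rewrite /ball /= sub0r normrN.
  have -> : f (x + t *: v) - f x - t * df =
      - t * (df - t^-1 *: (f (t *: v + x) - f x)).
    by rewrite (addrC x) /GRing.scale /=; field.
  by rewrite normrM normrN mulrC ler_wpM2r.
have fdf : (fun t => t^-1 *: (f (t *: v + x) - f x)) @ 0^' --> df.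
  apply/cvgrPdist_le => eps eps0; rewrite near_withinE /=.
  have [d d0 hd] := h _ eps0; apply/nbhs_ballP; exists d => // t td t0.
  have {}hd : `|f (x + t *: v) - f x - t * df| <= eps * `|t|.
    by apply: hd; move: td; rewrite /ball /= sub0r normrN.
  rewrite -(ler_pM2r (x := `|t|)) ?normr_gt0 //.
  apply: le_trans hd; rewrite -normrM -normrN (addrC x) le_eqVlt.
  apply/orP; left; apply/eqP; congr (`|_|); rewrite /GRing.scale /=.
  by field.
apply: DeriveDef; first by apply: cvgP fdf.
exact: cvg_lim fdf.
Qed.

Lemma expands2_taylor (g g1 : R -> R) c :
  (exists2 d : R, 0 < d & forall t : R, `|t| < d -> is_derive t 1 g (g1 t)) ->
  is_derive (0 : R) 1 g1 c -> expands2 g (g 0) (g1 0) (c / 2).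
Proof.
move=> [d d0 gd] /is_deriveP h eps eps0.
have [d' d'0 hd'] := h _ eps0.
exists (Num.min d d'); first by rewrite lt_min d0.
move=> t; rewrite lt_min => /andP[td td'].
pose k s := g s - (g 0 + g1 0 * s + c / 2 * s ^+ 2).
have k0 : k 0 = 0 by rewrite /k; ring.
have kd (s : R) : `|s| < d -> is_derive s 1 k (g1 s - g1 0 - s * c).
  move=> sd; have := gd _ sd => /is_deriveP gs; apply/is_deriveP => e e0.
  have [r r0 hr] := gs _ (divr_gt0 e0 (ltr0Sn _ 1)).
  have c0 : 0 < `|c| + 1 by rewrite ltr_wpDl.
  exists (Num.min r (e / (`|c| + 1))); first by rewrite lt_min r0 divr_gt0.
  move=> z; rewrite lt_min => /andP[/hr {}hr]; rewrite ltr_pdivlMr // => zc.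
  have -> : k (s + z *: 1) - k s - z * (g1 s - g1 0 - s * c) =
    (g (s + z *: 1) - g s - z * g1 s) - c / 2 * z * z.
    by rewrite /k /GRing.scale /=; field.
  apply: le_trans (ler_normB _ _) _.
  have : `|c / 2 * z * z| <= e / 2 * `|z|.
    rewrite 3!normrM (ger0_norm (x := 2^-1)) ?invr_ge0 //.
    rewrite ler_wpM2r //; have := normr_ge0 z; lra.
  lra.
have bnd (s : R) : `|s| <= `|t| -> `|g1 s - g1 0 - s * c| <= eps * `|t|.
  move=> st; have := hd' s (le_lt_trans st td').
  rewrite add0r /GRing.scale /= mulr1 => h1; apply: le_trans h1 _.
  by rewrite ler_wpM2l // ltW.
have tt : t ^+ 2 = `|t| * `|t| by rewrite -expr2 real_normK ?num_real.
suff : `|k t - k 0| <= eps * t ^+ 2 by rewrite k0 subr0.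
have cont (a b : R) : - d < a -> b < d -> {within `[a, b], continuous k}.
  move=> da bd; apply: derivable_within_continuous => s.
  rewrite in_itv /= => /andP[as_ sb].
  have sd : `|s| < d by rewrite ltr_norml; apply/andP; split; lra.
  by have [] := kd _ sd.
move: (td); rewrite ltr_norml => /andP[dt td1].
have [t0|t0|->] := ltgtP t 0; last by rewrite subrr normr0 expr0n mulr0.
- have [s|s] := @MVT_segment _ k (fun s => g1 s - g1 0 - s * c) _ _ (ltW t0) _ (cont t 0 dt d0).
    rewrite in_itv /= => /andP[ts s0]; apply: kd; rewrite ltr_norml; apply/andP; split; lra.
  rewrite in_itv /= => /andP[ts s0]; rewrite distrC sub0r => ->.
  rewrite normrM normrN tt mulrA ler_wpM2r //; apply: bnd.
  by rewrite !ler0_norm ?lerN2 // ltW.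
- have d0' : - d < 0 by rewrite oppr_lt0.
  have [s|s] := @MVT_segment _ k (fun s => g1 s - g1 0 - s * c) _ _ (ltW t0) _ (cont 0 t d0' td1).
    rewrite in_itv /= => /andP[s0 ts]; apply: kd; rewrite ltr_norml; apply/andP; split; lra.
  rewrite in_itv /= => /andP[s0 ts] ->; rewrite subr0.
  rewrite normrM tt mulrA ler_wpM2r //; apply: bnd.
  by rewrite !ger0_norm // ltW.
Qed.

End Expansions.

Section Jets.
Context {R : realType}.

Lemma mul_outer k l (p : 'cV[R]_l) (q xi : 'cV[R]_k) : p *m q^T *m xi = dot q xi *: p.
Proof.
by rewrite -mulmxA (mx11_scalar (q^T *m xi)) mul_mx_scalar dotE.
Qed.

Lemma mvt_signed (h h' : R -> R) b :
  (forall s : R, is_derive s 1 h (h' s)) ->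
  exists2 s, `|s| <= `|b| & h b - h 0 = h' s * b.
Proof.
move=> hh'.
have cont (p q : R) : {within `[p, q], continuous h}.
  by apply: derivable_within_continuous => s _; have [] := hh' s.
have [b0|b0|->] := ltgtP b 0; last by exists 0; rewrite ?subrr ?mulr0.
- have [s] := @MVT_segment _ h h' _ _ (ltW b0) (fun x _ => hh' x) (cont _ _).
  rewrite in_itv /= => /andP[bs s0] hE; exists s.
    by rewrite !ler0_norm ?lerN2 // ltW.
  by rewrite -opprB hE sub0r mulrN opprK.
- have [s] := @MVT_segment _ h h' _ _ (ltW b0) (fun x _ => hh' x) (cont _ _).
  rewrite in_itv /= => /andP[s0 sb] hE; exists s; last by rewrite hE subr0.
  by rewrite !ger0_norm // ltW.
Qed.

Lemma is_derive_line k (f : 'cV[R]_k -> R) x v (s : R) df :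
  is_derive (x + s *: v) v f df -> is_derive s 1 (fun t => f (x + t *: v)) df.
Proof.
move=> /is_deriveP h; apply/is_deriveP => eps eps0.
have [d d0 hd] := h _ eps0; exists d => // t td; have := hd _ td.
have -> : t%:A = t :> R by rewrite /GRing.scale /= mulr1.
by rewrite scalerDl addrA.
Qed.

Lemma is_derive_shiftl (f : R -> R) (a s df : R) :
  is_derive (a + s) 1 f df -> is_derive s 1 (fun t => f (a + t)) df.
Proof.
move=> /is_deriveP h; apply/is_deriveP => eps eps0.
have [d d0 hd] := h _ eps0; exists d => // t td; have := hd _ td.
by rewrite addrA.
Qed.

(** The step from partial to directional derivatives: continuity of one more
    partial derivative lets the direction acquire one more coordinate. *)
Lemma is_derive_add_coord k (f : 'cV[R]_k -> R) x v a i (c : R) :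
  (forall z, derivable f z (delta_mx i 0)) -> {for x, continuous (partial i f)} ->
  is_derive x v f a ->
  is_derive x (v + c *: delta_mx i 0) f (a + c * partial i f x).
Proof.
move=> df cf /is_deriveP fv; apply/is_deriveP => eps eps0.
have c0 : 0 < `|c| + 1 by rewrite ltr_wpDl.
have e0 : 0 < eps / 2 / (`|c| + 1) by rewrite !divr_gt0.
have : nbhs x [set z | `|partial i f x - partial i f z| <= eps / 2 / (`|c| + 1)].
  by move/cvgrPdist_le: cf => /(_ _ e0).
move=> /nbhs_ballP[r /= r0 hr].
have [d d0 hd] := fv _ (divr_gt0 eps0 (ltr0Sn _ 1)).
pose K : R := `|v| + `|c *: (delta_mx i 0 : 'cV[R]_k)| + 1.
have K0 : 0 < K by rewrite /K ltr_wpDl // addr_ge0.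
exists (Num.min d (r / K)); first by rewrite lt_min d0 divr_gt0.
move=> t; rewrite lt_min ltr_pdivlMr // => /andP[td tr].
have hder (s : R) : is_derive s 1 (fun s => f (x + t *: v + s *: delta_mx i 0))
    (partial i f (x + t *: v + s *: delta_mx i 0)).
  by apply: is_derive_line; apply: derivableP.
have [s st sE] := mvt_signed (t * c) hder.
have -> : f (x + t *: (v + c *: delta_mx i 0)) - f x - t * (a + c * partial i f x) =
    (f (x + t *: v) - f x - t * a) +
    (partial i f (x + t *: v + s *: delta_mx i 0) - partial i f x) * (t * c).
  rewrite [X in _ = _ + X]mulrBl -sE scale0r addr0 scalerDr scalerA addrA.
  ring.
apply: le_trans (ler_normD _ _) _.
have h2 : `|partial i f (x + t *: v + s *: delta_mx i 0) - partial i f x| <=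
    eps / 2 / (`|c| + 1).
  rewrite distrC; apply: hr; rewrite -ball_normE /ball_ /=.
  rewrite -addrA opprD addrA subrr sub0r normrN.
  apply: le_lt_trans (ler_normD _ _) _; apply: le_lt_trans tr.
  have hs : `|s *: (delta_mx i 0 : 'cV[R]_k)| <= `|t| * `|c *: (delta_mx i 0 : 'cV[R]_k)|.
    by rewrite !normrZ mulrA -normrM ler_wpM2r.
  by rewrite normrZ /K; have := normr_ge0 t; lra.
have h3 : `|(partial i f (x + t *: v + s *: delta_mx i 0) - partial i f x) * (t * c)|
    <= eps / 2 * `|t|.
  rewrite normrM; apply: le_trans (ler_wpM2r (normr_ge0 _) h2) _.
  rewrite normrM mulrCA [leRHS]mulrC ler_wpM2l //.
  rewrite mulrAC ler_pdivrMr // ler_wpM2l ?divr_ge0 ?(ltW eps0) //.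
  by rewrite lerDl.
have := hd _ td; lra.
Qed.

Lemma is_derive_grad k (f : 'cV[R]_k -> R) x v :
  (forall i z, derivable f z (delta_mx i 0)) ->
  (forall i, continuous (partial i f)) ->
  is_derive x v f (dot (grad f x) v).
Proof.
move=> df cf.
have -> : v = \sum_i v i 0 *: delta_mx i 0.
  rewrite {1}(matrix_sum_delta v); apply: eq_bigr => i _.
  by rewrite big_ord1.
have -> : dot (grad f x) (\sum_i v i 0 *: delta_mx i 0) =
    \sum_i v i 0 * partial i f x.
  apply: eq_bigr => i _; rewrite summxE (bigD1 i) //= big1 ?addr0.
    by rewrite !mxE !eqxx mulr1 mulrC.
  by move=> j ji; rewrite !mxE eq_sym (negbTE ji) mulr0.
elim: (index_enum _) => [|i s ih]; first by rewrite !big_nil; exact: is_derive0.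
rewrite !big_cons (addrC (_ *: _)) (addrC (_ * _)).
by apply: is_derive_add_coord => //; exact: cf.
Qed.

(** A second-order expansion along every line: all that is needed of twice
    differentiability at a maximum point, and stable under composition with
    functions of one variable. *)
Definition jet2 k (u : 'cV[R]_k -> R) y (q : 'cV[R]_k) (X : 'M[R]_k) :=
  forall xi, expands2 (fun t => u (y + t *: xi)) (u y) (dot q xi)
    (dot xi (X *m xi) / 2).

(** Along a line only the quadratic form of the Hessian matters, so the order of
    the two differentiations in its entries is harmless. *)
Lemma jet2_C2 k (w : 'cV[R]_k -> R) y : C2 w -> jet2 w y (grad w y) (hess w y).
Proof.
move=> [_ dw cdw ddw cddw] xi.
pose g1 (t : R) := dot (grad w (y + t *: xi)) xi.
have -> : w y = w (y + 0 *: xi) by rewrite scale0r addr0.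
have -> : dot (grad w y) xi = g1 0 by rewrite /g1 scale0r addr0.
apply: (@expands2_taylor _ (fun t => w (y + t *: xi)) g1).
  exists 1 => // t _; apply: is_derive_line; exact: is_derive_grad.
have -> : g1 = \sum_(j < k) (xi j 0 \*: (fun t => partial j w (y + t *: xi))).
  apply/funext => t; rewrite /g1 /dot fct_sumE; apply: eq_bigr => j _.
  by rewrite mxE mulrC.
have -> : dot xi (hess w y *m xi) =
    \sum_(j < k) xi j 0 *: dot (grad (partial j w) y) xi.
  rewrite /dot; under eq_bigr do rewrite mxE mulr_sumr.
  rewrite exchange_big /=; apply: eq_bigr => j _.
  rewrite /GRing.scale /= mulr_sumr; apply: eq_bigr => i _; rewrite !mxE; ring.
apply: is_derive_sum => j; apply: is_deriveZ; apply: is_derive_line.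
rewrite scale0r addr0; apply: is_derive_grad.
  by move=> i z; exact: ddw.
by move=> i; exact: cddw.
Qed.

Lemma jet2B k (u v : 'cV[R]_k -> R) y q q' X X' :
  jet2 u y q X -> jet2 v y q' X' -> jet2 (fun y => u y - v y) y (q - q') (X - X').
Proof.
move=> hu hv xi; apply: expands2_eq (expands2B (hu xi) (hv xi)) => //.
  by rewrite dotBl.
by rewrite mulmxBl dotBr mulrBl.
Qed.

Lemma jet2D k (u v : 'cV[R]_k -> R) y q q' X X' :
  jet2 u y q X -> jet2 v y q' X' -> jet2 (fun y => u y + v y) y (q + q') (X + X').
Proof.
move=> hu hv xi; apply: expands2_eq (expands2D (hu xi) (hv xi)) => //.
  by rewrite dotDl.
by rewrite mulmxDl dotDr mulrDl.
Qed.

Lemma jet2Z k a (u : 'cV[R]_k -> R) y q X :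
  jet2 u y q X -> jet2 (fun y => a * u y) y (a *: q) (a *: X).
Proof.
move=> hu xi; apply: expands2_eq (expands2Z a (hu xi)) => //.
  by rewrite dotZl.
by rewrite -scalemxAl dotZr mulrA.
Qed.

Lemma jet2_comp k (F : R -> R) (u : 'cV[R]_k -> R) y q X f1 f2 :
  jet2 u y q X -> expands2 (fun s => F (u y + s)) (F (u y)) f1 f2 ->
  jet2 (F \o u) y (f1 *: q) (f1 *: X + (2 * f2) *: (q *m q^T)).
Proof.
move=> hu hF xi; apply: expands2_eq (expands2_comp (hu xi) hF) => //.
  by rewrite dotZl.
rewrite mulmxDl -!scalemxAl mul_outer !dotDE (dotC xi q); by field.
Qed.

Lemma jet2_sqr k (c y : 'cV[R]_k) :
  jet2 (fun z => dot (z - c) (z - c)) y (2 *: (y - c)) (2%:M).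
Proof.
move=> xi; apply: expands2_poly => t.
rewrite [y + _ - _]addrAC mul_scalar_mx !dotDE (dotC xi y) (dotC xi c) (dotC c y).
by field.
Qed.

Lemma expands2_expR (a : R) :
  expands2 (fun s => expR (a + s)) (expR a) (expR a) (expR a / 2).
Proof.
have -> : expR a = (fun s => expR (a + s)) 0 by rewrite addr0.
have der (s : R) : is_derive s 1 (fun s => expR (a + s)) (expR (a + s)).
  exact: is_derive_shiftl.
by apply: (@expands2_taylor _ _ (fun s => expR (a + s))); exists 1.
Qed.

Lemma expands2_sqrt (r : R) : 0 < r ->
  expands2 (fun s => Num.sqrt (r ^+ 2 + s)) r (2 * r)^-1 (- (8 * r ^+ 3)^-1).
Proof.
move=> r0; have sr : Num.sqrt (r ^+ 2) = r by rewrite sqrtr_sqr gtr0_norm.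
have r20 : 0 < r ^+ 2 by rewrite exprn_gt0.
pose g (s : R) := Num.sqrt (r ^+ 2 + s).
pose g1 (s : R) := (2 * Num.sqrt (r ^+ 2 + s))^-1.
have gd (s : R) : `|s| < r ^+ 2 -> is_derive s 1 g (g1 s).
  rewrite ltr_norml => /andP[h _]; apply: is_derive_shiftl.
  by apply: is_derive1_sqrt; lra.
have g1d : is_derive (0 : R) 1 g1 (- (4 * r ^+ 3)^-1).
  have d0 := gd 0; rewrite normr0 in d0.
  have h2 := @is_deriveZ _ _ _ g 2 _ _ _ (d0 r20).
  have g2 : (2 \*: g) 0 = 2 * r by rewrite /= /g addr0 sr.
  have g2n : (2 \*: g) 0 != 0 by rewrite g2 mulf_neq0 ?gt_eqF.
  apply: is_derive_eq (is_deriveV g2n h2) _.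
  rewrite g2 /g1 addr0 sr /GRing.scale /=; field.
  by rewrite gt_eqF.
have gd' : exists2 d : R, 0 < d & forall s : R, `|s| < d -> is_derive s 1 g (g1 s).
  by exists (r ^+ 2).
have := expands2_taylor gd' g1d.
apply: expands2_eq => //; rewrite /g /g1 ?addr0 ?sr //.
by field; rewrite gt_eqF.
Qed.

Lemma expands2_enorm k (x xi : 'cV[R]_k) : x != 0 ->
  let r := enorm x in let e := r^-1 *: x in
  expands2 (fun t => enorm (x + t *: xi)) r (dot e xi)
    ((dot xi xi - dot e xi ^+ 2) / (2 * r)).
Proof.
rewrite -enorm_gt0 => r0 r e.
have h : expands2 (fun t => dot (x + t *: xi) (x + t *: xi)) (r ^+ 2)
    (2 * dot x xi) (dot xi xi).
  by apply: expands2_poly => t; rewrite enorm_sqr !dotDE (dotC xi x); ring.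
apply: expands2_eq (expands2_comp h (expands2_sqrt r0)) => //.
  by rewrite /e dotZl -/r; field; rewrite gt_eqF.
by rewrite /e dotZl -/r; field; rewrite gt_eqF.
Qed.

Lemma line_max k (u : 'cV[R]_k -> R) y q X : jet2 u y q X ->
  (forall xi : 'cV[R]_k, exists2 d : R, 0 < d & forall t : R, `|t| < d -> u (y + t *: xi) <= u y) ->
  q = 0 /\ forall l (A : 'M[R]_(k, l)), \tr (A *m A^T *m X) <= 0.
Proof.
move=> hu umax.
have key xi : dot q xi = 0 /\ dot xi (X *m xi) / 2 <= 0.
  apply: (expands2_max (hu xi)); have [d d0 hd] := umax xi.
  by exists d => // t td; rewrite scale0r addr0 hd.
split.
  apply: enorm_eq0; apply/eqP; rewrite -sqrf_eq0 enorm_sqr.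
  by have [-> _] := key q.
move=> l A; rewrite mxtrace_cols; apply: sumr_le0 => j _.
by have [_] := key (col j A); lra.
Qed.

(** The maximum principle for doubled variables.  At an off-diagonal maximum of
    [u1 y - u2 z - phi |y - z|] the two gradients coincide, and choosing the
    displacements of the two points as the columns of [A] and of [B] (a coupling
    of two diffusions) compares second-order parts: the difference [A - B] sees
    [phi''] along the line joining the points and [phi' / r] across it. *)
Lemma two_point_max k (u1 u2 : 'cV[R]_k -> R) (y z : 'cV[R]_k) q q' X X' (phi : R -> R) f1 f2
    (r := enorm (y - z)) (e := r^-1 *: (y - z)) :
  y != z -> jet2 u1 y q X -> jet2 u2 z q' X' ->
  expands2 (fun s => phi (r + s)) (phi r) f1 f2 ->
  (forall xi eta : 'cV[R]_k, exists2 d : R, 0 < d & forall t : R, `|t| < d ->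
    u1 (y + t *: xi) - u2 (z + t *: eta)
      - phi (enorm (y + t *: xi - (z + t *: eta))) <= u1 y - u2 z - phi r) ->
  [/\ q = f1 *: e, q' = f1 *: e & forall l (A B : 'M[R]_(k, l)),
    \tr (A *m A^T *m X) - \tr (B *m B^T *m X') <=
      2 * f2 * enorm ((A - B)^T *m e) ^+ 2
      + f1 / r * (fro2 (A - B) - enorm ((A - B)^T *m e) ^+ 2)].
Proof.
rewrite -subr_eq0 => yz h1 h2 hphi hmax.
have r0 : 0 < r by rewrite /r enorm_gt0.
have key xi eta :
    dot q xi - dot q' eta - f1 * dot e (xi - eta) = 0 /\
    dot xi (X *m xi) / 2 - dot eta (X' *m eta) / 2 -
      (f1 * ((dot (xi - eta) (xi - eta) - dot e (xi - eta) ^+ 2) / (2 * r)) +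
       f2 * dot e (xi - eta) ^+ 2) <= 0.
  have hn := expands2_comp (expands2_enorm (xi - eta) yz) hphi.
  have h := expands2B (expands2B (h1 xi) (h2 eta)) hn.
  apply: (expands2_max h); have [d d0 hd] := hmax xi eta.
  exists d => // t /hd /=.
  rewrite !scale0r !addr0.
  by rewrite opprD addrACA -scalerBr.
have qE : q = f1 *: e.
  apply/eqP; rewrite -subr_eq0; apply/eqP/enorm_eq0/eqP.
  rewrite -sqrf_eq0 enorm_sqr; set p := q - _.
  have [h _] := key p 0; rewrite subr0 dot0r subr0 in h.
  by rewrite {1}/p dotBl dotZl h.
have qE' : q' = f1 *: e.
  apply/eqP; rewrite -subr_eq0; apply/eqP/enorm_eq0/eqP.
  rewrite -sqrf_eq0 enorm_sqr; set p := q' - _.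
  have [h _] := key 0 p; rewrite sub0r dotNr dot0r in h.
  by rewrite {1}/p dotBl dotZl; apply/eqP; lra.
split=> // l A B.
rewrite !mxtrace_cols fro2_cols enorm_tr_cols -!sumrB.
rewrite !mulr_sumr -big_split /=; apply: ler_sum => j _.
have [_] := key (col j A) (col j B); rewrite -linearB /=.
set s := dot _ (X *m _); set s' := dot _ (X' *m _).
set n := dot (col j (A - B)) _; set m := dot e _.
have -> : f1 * ((n - m ^+ 2) / (2 * r)) = (f1 / r * (n - m ^+ 2)) / 2.
  by field; rewrite gt_eqF.
lra.
Qed.
End Jets.

(** * Couplings of two elliptic matrices *)

Section Coupling.
Context {R : realType}.

Lemma mxtrace_outer k (p q : 'cV[R]_k) : \tr (p *m q^T) = dot p q.
Proof.
by rewrite mxtrace_mulC dotC dotE trace_mx11.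
Qed.

Lemma fro2_add_outer k l (D : 'M[R]_(k, l)) e v : dot e e = 1 ->
  fro2 (D + e *m v^T) - enorm ((D + e *m v^T)^T *m e) ^+ 2 =
  fro2 D - enorm (D^T *m e) ^+ 2.
Proof.
move=> ee.
have vE : (D + e *m v^T)^T *m e = D^T *m e + v.
  by rewrite linearD /= trmx_mul trmxK mulmxDl mul_outer ee scale1r.
have -> : fro2 (D + e *m v^T) = fro2 D + 2 * dot v (D^T *m e) + dot v v.
  rewrite /fro2 linearD /= trmx_mul trmxK mulmxDl !mulmxDr !linearD /=.
  rewrite mulmxA mxtrace_outer -mulmxA -trmx_mul mxtrace_outer.
  rewrite mulmxA -(mulmxA e) (mx11_scalar (v^T *m v)) -dotE mul_mx_scalar.
  rewrite -scalemxAl linearZ /= mxtrace_outer ee (dotC (D *m v)) dot_mulr.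
  by rewrite (dotC (D^T *m e)); ring.
rewrite vE !enorm_sqr !dotDE (dotC (D^T *m e) v); ring.
Qed.

Definition elliptic k (th : R) (A : 'M[R]_k) :=
  forall xi, th * enorm xi ^+ 2 <= enorm (A^T *m xi) ^+ 2.

Lemma elliptic_unitmx k th (A : 'M[R]_k) : 0 < th -> elliptic th A -> A \in unitmx.
Proof.
move=> th0 hA; rewrite -row_free_unit; apply: inj_row_free => v vA.
apply: trmx_inj; rewrite trmx0; apply: enorm_eq0; apply/eqP.
have := hA v^T; rewrite -trmx_mul vA trmx0 enorm0 expr0n /= => h.
rewrite -sqrf_eq0 eq_le sqr_ge0 andbT.
by rewrite -(pmulr_rle0 _ th0).
Qed.

Lemma elliptic_mul k th (A : 'M[R]_k) u : 0 < th -> elliptic th A ->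
  th * enorm u ^+ 2 <= enorm (A *m u) ^+ 2.
Proof.
move=> th0 hA; have uA := elliptic_unitmx th0 hA.
have [->|u0] := eqVneq u 0; first by rewrite mulmx0 enorm0 expr0n mulr0.
pose xi := invmx A^T *m u.
have uE : A^T *m xi = u by rewrite mulKVmx // unitmx_tr.
have := hA xi; rewrite uE => hxi.
have h1 : enorm u ^+ 2 <= enorm xi * enorm (A *m u).
  by rewrite enorm_sqr -{1}uE -dot_mulr dot_le.
rewrite -enorm_gt0 in u0; have u20 : 0 < enorm u ^+ 2 by rewrite exprn_gt0.
rewrite -(ler_pM2r u20) -mulrA.
apply: (@le_trans _ _ (th * (enorm xi * enorm (A *m u)) ^+ 2)).
  rewrite ler_wpM2l ?(ltW th0) // -expr2 ler_pXn2r ?nnegrE ?sqr_ge0 //.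
  by rewrite mulr_ge0 ?enorm_ge0.
by rewrite exprMn mulrA mulrC ler_wpM2l // sqr_ge0.
Qed.

(** Reflection coupling: [B] is composed with the reflection that exchanges
    [B^-1 e] with its opposite.  The rank-one correction lies in the direction
    [e], so it produces ellipticity along [e] at no cost across it. *)
Lemma reflection_coupling k (A B : 'M[R]_k) e th s :
  0 < th -> elliptic th B -> enorm e = 1 -> 0 <= s -> s ^+ 2 <= th ->
  fro2 (A - B) <= s ^+ 2 ->
  exists B' : 'M[R]_k, [/\ B' *m B'^T = B *m B^T,
    th <= enorm ((A - B')^T *m e) ^+ 2 &
    fro2 (A - B') - enorm ((A - B')^T *m e) ^+ 2 <= s ^+ 2].
Proof.
move=> th0 hB e1 s0 sth hs; have uB := elliptic_unitmx th0 hB.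
have ee : dot e e = 1 by rewrite -enorm_sqr e1 expr1n.
pose u := invmx B *m e; have Bu : B *m u = e by rewrite mulKVmx.
have hu := elliptic_mul u th0 hB; rewrite Bu e1 expr1n in hu.
have u0 : 0 < enorm u.
  by rewrite enorm_gt0; apply/eqP => u0; move: e1 => /eqP;
    rewrite -Bu u0 mulmx0 enorm0 eq_sym oner_eq0.
pose c := 2 / enorm u ^+ 2.
have cu : c * dot u u = 2 by rewrite -enorm_sqr /c divfK // gt_eqF ?exprn_gt0.
exists (B - e *m (c *: u)^T).
have -> : A - (B - e *m (c *: u)^T) = (A - B) + e *m (c *: u)^T.
  by rewrite opprB addrA addrAC.
split.
- rewrite linearB /= trmx_mul trmxK mulmxBl !mulmxBr.
  rewrite !mulmxA -(mulmxA e _ (c *: u)) -[B *m (c *: u)]scalemxAr Bu.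
  rewrite -[e *m (c *: u)^T *m B^T]mulmxA -trmx_mul -scalemxAr Bu.
  rewrite (mx11_scalar ((c *: u)^T *m (c *: u))) -dotE mul_mx_scalar.
  have -> : dot (c *: u) (c *: u) = c * 2 by rewrite dotZl dotZr cu.
  have -> : e *m (c *: e)^T = c *: (e *m e^T) by rewrite linearZ /= -scalemxAr.
  rewrite -!scalemxAl -scalerBl -addrA -opprD -scalerDl.
  by rewrite (_ : c + (c - c * 2) = 0) ?scale0r ?subr0 //; ring.
- rewrite linearD /= trmx_mul trmxK mulmxDl mul_outer ee scale1r.
  have h1 : enorm (c *: u) = 2 / enorm u.
    rewrite enormZ ger0_norm ?divr_ge0 ?sqr_ge0 //.
    by rewrite /c; field; rewrite gt_eqF.
  have h2 : enorm ((A - B)^T *m e) <= s.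
    rewrite -(ler_pXn2r (n := 2)) ?nnegrE ?enorm_ge0 //.
    apply: le_trans (enorm_mul_sqr_le _ _) _.
    by rewrite e1 expr1n mulr1 fro2_tr.
  have sq : Num.sqrt th ^+ 2 = th by rewrite sqr_sqrtr // ltW.
  have s_le : s <= Num.sqrt th.
    by rewrite -(ler_pXn2r (n := 2)) ?nnegrE ?sqrtr_ge0 // sq.
  have h3 : Num.sqrt th <= (enorm u)^-1.
    rewrite -(ler_pXn2r (n := 2)) ?nnegrE ?sqrtr_ge0 ?invr_ge0 ?enorm_ge0 //.
    by rewrite sq exprVn -[leRHS]mul1r ler_pdivlMr // exprn_gt0.
  have h4 := enorm_sub_le (c *: u) (- ((A - B)^T *m e)).
  rewrite enormN opprK [c *: u + _]addrC h1 in h4.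
  by rewrite -[leLHS]sq ler_pXn2r ?nnegrE ?sqrtr_ge0 ?enorm_ge0 //; lra.
- by rewrite fro2_add_outer //; have := sqr_ge0 (enorm ((A - B)^T *m e)); lra.
Qed.

(** Independent coupling: ellipticity along [e] whatever the distance between
    the two matrices, at a cost bounded by their size. *)
Lemma independent_coupling k (A B : 'M[R]_k) e th :
  0 <= th -> elliptic th A -> enorm e = 1 ->
  exists A' B' : 'M[R]_(k, k + k), [/\ A' *m A'^T = A *m A^T,
    B' *m B'^T = B *m B^T,
    th <= enorm ((A' - B')^T *m e) ^+ 2 &
    fro2 (A' - B') - enorm ((A' - B')^T *m e) ^+ 2 <= fro2 A + fro2 B].
Proof.
move=> th0 hA e1; exists (row_mx A 0), (row_mx 0 B).
have DE : row_mx A 0 - row_mx 0 B = row_mx A (- B).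
  by rewrite opp_row_mx add_row_mx oppr0 addr0 add0r.
have DD : row_mx A (- B) *m (row_mx A (- B))^T = A *m A^T + B *m B^T.
  by rewrite tr_row_mx mul_row_col linearN /= mulmxN mulNmx opprK.
have n2 : enorm ((row_mx A (- B))^T *m e) ^+ 2 =
    enorm (A^T *m e) ^+ 2 + enorm (B^T *m e) ^+ 2.
  by rewrite !enorm_sqr !dot_mull !trmxK !mulmxA DD mulmxDl dotDr.
rewrite DE; split.
- by rewrite tr_row_mx mul_row_col trmx0 mul0mx addr0.
- by rewrite tr_row_mx mul_row_col trmx0 mul0mx add0r.
- rewrite n2; have := hA e; rewrite e1 expr1n mulr1.
  by have := sqr_ge0 (enorm (B^T *m e)); lra.
- rewrite {1}/fro2 DD linearD /= -/(fro2 A) -/(fro2 B) n2.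
  by have := sqr_ge0 (enorm (A^T *m e)); have := sqr_ge0 (enorm (B^T *m e)); lra.
Qed.

Definition coupling_cost (th L T : R) := L * Num.sqrt th + 2 * T * L / Num.sqrt th.

(** Reflection is used at short range, independence beyond it; in both regimes
    the cost is at most proportional to the distance. *)
Lemma coupling k (A B : 'M[R]_k) e th L T r :
  0 < th -> elliptic th A -> elliptic th B -> enorm e = 1 -> 0 < r -> 0 < L ->
  fro2 (A - B) <= (L * r) ^+ 2 -> fro2 A <= T -> fro2 B <= T ->
  exists l (A' B' : 'M[R]_(k, l)), [/\ A' *m A'^T = A *m A^T,
    B' *m B'^T = B *m B^T,
    th <= enorm ((A' - B')^T *m e) ^+ 2 &
    fro2 (A' - B') - enorm ((A' - B')^T *m e) ^+ 2 <= coupling_cost th L T * r].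
Proof.
move=> th0 hA hB e1 r0 L0 hAB hAT hBT.
have T0 : 0 <= T := le_trans (fro2_ge0 A) hAT.
have sq : Num.sqrt th ^+ 2 = th by rewrite sqr_sqrtr // ltW.
have s0 : 0 < Num.sqrt th by rewrite sqrtr_gt0.
have Lr0 : 0 < L * r by rewrite mulr_gt0.
have Tq : 0 <= 2 * T * L / Num.sqrt th by rewrite divr_ge0 ?mulr_ge0 // ltW.
have [Lr|Lr] := leP (L * r) (Num.sqrt th).
- have Lr2 : (L * r) ^+ 2 <= th by rewrite -sq ler_pXn2r ?nnegrE ?(ltW Lr0) ?(ltW s0).
  have [B' [h1 h2 h3]] := reflection_coupling th0 hB e1 (ltW Lr0) Lr2 hAB.
  exists k, A, B'; split=> //; apply: le_trans h3 _.
  rewrite /coupling_cost mulrDl; have := mulr_ge0 Tq (ltW r0).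
  have : (L * r) ^+ 2 <= L * r * Num.sqrt th by rewrite expr2 ler_wpM2l // ltW //.
  lra.
- have [A' [B' [h1 h2 h3 h4]]] := independent_coupling B (ltW th0) hA e1.
  exists (k + k)%N, A', B'; split=> //; apply: le_trans h4 _.
  rewrite /coupling_cost mulrDl.
  have : 0 <= L * Num.sqrt th * r by rewrite !mulr_ge0 // ltW.
  have -> : 2 * T * L / Num.sqrt th * r = 2 * T * (L * r / Num.sqrt th).
    by field; rewrite gt_eqF.
  have : 2 * T * 1 <= 2 * T * (L * r / Num.sqrt th).
    by rewrite ler_wpM2l ?mulr_ge0 // ler_pdivlMr // mul1r ltW.
  lra.
Qed.

End Coupling.

(** * Doubling of variables on the whole space *)

Section Doubling.
Context {R : realType}.

Lemma compact_max_at (T : topologicalType) (G : T -> R) (K : set T) x0 :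
  K x0 -> compact K -> (forall x, K x -> {for x, continuous G}) ->
  exists2 x, K x & forall y, K y -> G y <= G x.
Proof.
move=> Kx0 cK cG.
have cG' : {within K, continuous G}.
  by apply: continuous_in_subspaceT => x; rewrite inE; exact: cG.
have [|x xK xmax] := compact_EVT_max _ cK cG'; first by exists x0.
by exists x; [move: xK; rewrite inE|move=> y Ky; apply: xmax; rewrite inE].
Qed.

Lemma compact_max (T : topologicalType) (G : T -> R) (K : set T) x0 :
  K x0 -> compact K -> continuous G -> exists2 x, K x & forall y, K y -> G y <= G x.
Proof. by move=> Kx0 cK cG; exact: compact_max_at Kx0 cK (fun x _ => cG x). Qed.

Lemma continuous_addr (T : topologicalType) (f g : T -> R) :
  continuous f -> continuous g -> continuous (fun x => f x + g x).
Proof. by move=> cf cg x; exact: (@cvgD R R T (nbhs x) _ f g _ _ (cf x) (cg x)). Qed.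

Lemma continuous_subr (T : topologicalType) (f g : T -> R) :
  continuous f -> continuous g -> continuous (fun x => f x - g x).
Proof. by move=> cf cg x; exact: (@cvgB R R T (nbhs x) _ f g _ _ (cf x) (cg x)). Qed.

Lemma continuous_mulr (T : topologicalType) (f g : T -> R) :
  continuous f -> continuous g -> continuous (fun x => f x * g x).
Proof. by move=> cf cg x; exact: (@continuousM R T f g x (cf x) (cg x)). Qed.

Lemma continuous_scaler (T : topologicalType) (f : T -> R) (c : R) :
  continuous f -> continuous (fun x => c * f x).
Proof. by apply: continuous_mulr => x; exact: cvg_cst. Qed.

Lemma dot_sub_continuous k (c : 'cV[R]_k) :
  continuous (fun y : 'cV[R]_k => dot (y - c) (y - c)).
Proof.
have -> : (fun y : 'cV[R]_k => dot (y - c) (y - c)) =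
          (fun y => enorm (y - c) * enorm (y - c)).
  by apply/funext => y; rewrite -expr2 enorm_sqr.
move=> y; have h := @enorm_subl_continuous R k c y.
exact: (@continuousM R _ _ _ y h h).
Qed.

Lemma enorm_unit k (x : 'cV[R]_k) : x != 0 -> enorm ((enorm x)^-1 *: x) = 1.
Proof.
rewrite -enorm_gt0 => x0.
by rewrite enormZ ger0_norm ?invr_ge0 ?enorm_ge0 // mulVf // gt_eqF.
Qed.

Lemma enormZ_unit k (x : 'cV[R]_k) : enorm x *: ((enorm x)^-1 *: x) = x.
Proof.
have [->|] := eqVneq x 0; first by rewrite !scaler0.
by rewrite -enorm_gt0 => x0; rewrite scalerA divff ?scale1r // gt_eqF.
Qed.

Lemma continuous_fst_comp (U V : topologicalType) (f : U -> R) :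
  continuous f -> continuous (fun p : U * V => f p.1).
Proof.
by move=> cf p; apply: (@continuous_comp _ _ _ fst f); [exact: cvg_fst|exact: cf].
Qed.

Lemma continuous_snd_comp (U V : topologicalType) (f : V -> R) :
  continuous f -> continuous (fun p : U * V => f p.2).
Proof.
by move=> cf p; apply: (@continuous_comp _ _ _ snd f); [exact: cvg_snd|exact: cf].
Qed.

Lemma mxtrace_sub_scalar k l (A : 'M[R]_(k, l)) X (c : R) :
  \tr (A *m A^T *m (X - c *: 2%:M)) = \tr (A *m A^T *m X) - 2 * c * fro2 A.
Proof.
rewrite mulmxBr linearB /= -scalemxAr mul_mx_scalar !linearZ /= -/(fro2 A).
by rewrite scalerA (mulrC c) scalerN /GRing.scale.
Qed.

(** If [w y - w z <= phi |y - z|] fails somewhere, it fails at points where the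
    maximum principle for doubled variables applies: the maximum is made to
    exist by the penalization [eps (|y|^2 + |z|^2)], and the failure [eta] does not
    deteriorate as [eps] tends to 0. *)
Lemma doubling k (w : 'cV[R]_k -> R) gw Hw W (phi f1 f2 : R -> R) y0 z0 :
  continuous w -> (forall y, jet2 w y (gw y) (Hw y)) -> (forall y, `|w y| <= W) ->
  continuous phi -> phi 0 = 0 -> (forall r, 0 <= r -> 0 <= phi r) ->
  (forall r, 0 < r -> expands2 (fun s => phi (r + s)) (phi r) (f1 r) (f2 r)) ->
  phi (enorm (y0 - z0)) < w y0 - w z0 ->
  exists2 eta : R, 0 < eta & forall eps0 : R, 0 < eps0 ->
    exists eps y z, let r := enorm (y - z) in let e := r^-1 *: (y - z) in
    [/\ [/\ 0 < eps, eps < eps0 & y != z],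
        eta + eps * (dot y y + dot z z) <= w y - w z,
        gw y = f1 r *: e + (2 * eps) *: y,
        gw z = f1 r *: e - (2 * eps) *: z &
        forall l (A B : 'M[R]_(k, l)),
          \tr (A *m A^T *m Hw y) - \tr (B *m B^T *m Hw z) <=
          2 * f2 r * enorm ((A - B)^T *m e) ^+ 2
          + f1 r / r * (fro2 (A - B) - enorm ((A - B)^T *m e) ^+ 2)
          + 2 * eps * (fro2 A + fro2 B)].
Proof.
move=> cw jw bw cphi phi0 phi_ge0 jphi h0.
pose gap := w y0 - w z0 - phi (enorm (y0 - z0)).
have gap0 : 0 < gap by rewrite subr_gt0.
exists (gap / 2); first by rewrite divr_gt0.
move=> eps0 eps00; pose N := dot y0 y0 + dot z0 z0.
have N0 : 0 <= N by rewrite addr_ge0 ?dot_ge0.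
have N1 : 0 < 2 * (N + 1) by rewrite mulr_gt0 // ltr_wpDl.
pose eps : R := Num.min (eps0 / 2) (gap / (2 * (N + 1))).
have eps_gt0 : 0 < eps by rewrite lt_min !divr_gt0.
have eps_lt : eps < eps0 by rewrite gt_min; apply/orP; left; lra.
have epsN : eps * N <= gap / 2.
  have : eps * (2 * (N + 1)) <= gap by rewrite -ler_pdivlMr // ge_min lexx orbT.
  lra.
pose G (p : 'cV[R]_k * 'cV[R]_k) := w p.1 - w p.2 - phi (enorm (p.1 - p.2)) -
  eps * (dot (p.1 - 0) (p.1 - 0) + dot (p.2 - 0) (p.2 - 0)).
have cG : continuous G.
  rewrite /G; apply: continuous_subr; last first.
    apply: continuous_scaler; apply: continuous_addr.
      exact: (@continuous_fst_comp _ _ _ (@dot_sub_continuous _ 0)).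
    exact: (@continuous_snd_comp _ _ _ (@dot_sub_continuous _ 0)).
  apply: continuous_subr; last first.
    move=> p; apply: (@continuous_comp _ _ _ (fun p : 'cV[R]_k * 'cV[R]_k => enorm (p.1 - p.2)) phi).
      exact: enorm_sub_continuous.
    exact: cphi.
  apply: continuous_subr.
    exact: (@continuous_fst_comp _ _ _ cw).
  exact: (@continuous_snd_comp _ _ _ cw).
have W0 : 0 <= W := le_trans (normr_ge0 _) (bw 0).
pose rho := Num.sqrt (2 * W / eps).
have rho2 : eps * rho ^+ 2 = 2 * W.
  by rewrite sqr_sqrtr ?divr_ge0 ?mulr_ge0 ?(ltW eps_gt0) // mulrC divfK // gt_eqF.
pose K := [set y : 'cV[R]_k | enorm (y - 0) <= rho].
have cK : compact (K `*` K) by apply: compact_setX; exact: compact_eball.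
have K00 : (K `*` K) (0, 0).
  by split; rewrite /K /= subr0 enorm0 sqrtr_ge0.
have [[y z] _ /= Kmax] := compact_max K00 cK cG.
have Gmax y' z' : G (y', z') <= G (y, z).
  have [yK|yK] := leP (enorm (y' - 0)) rho; last first.
    apply: le_trans (Kmax (0, 0) K00).
    rewrite /G /= !subr0 !dot0l enorm0 phi0 addr0 mulr0 subrr.
    have := bw y'; have := bw z'; rewrite !ler_norml => /andP[a1 a2] /andP[a3 a4].
    have := phi_ge0 _ (enorm_ge0 (y' - z')).
    have : eps * rho ^+ 2 <= eps * dot y' y'.
      rewrite ler_wpM2l ?(ltW eps_gt0) // -enorm_sqr ler_pXn2r ?nnegrE ?sqrtr_ge0 ?enorm_ge0 //.
      by rewrite subr0 in yK; exact: ltW.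
    have := mulr_ge0 (ltW eps_gt0) (dot_ge0 z'); lra.
  have [zK|zK] := leP (enorm (z' - 0)) rho; last first.
    apply: le_trans (Kmax (0, 0) K00).
    rewrite /G /= !subr0 !dot0l enorm0 phi0 addr0 mulr0 subrr.
    have := bw y'; have := bw z'; rewrite !ler_norml => /andP[a1 a2] /andP[a3 a4].
    have := phi_ge0 _ (enorm_ge0 (y' - z')).
    have : eps * rho ^+ 2 <= eps * dot z' z'.
      rewrite ler_wpM2l ?(ltW eps_gt0) // -enorm_sqr ler_pXn2r ?nnegrE ?sqrtr_ge0 ?enorm_ge0 //.
      by rewrite subr0 in zK; exact: ltW.
    have := mulr_ge0 (ltW eps_gt0) (dot_ge0 y'); lra.
  exact: Kmax (y', z') (conj yK zK).
have G0 := Gmax y0 z0; rewrite /G /= !subr0 -/N -/gap in G0.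
have ph := phi_ge0 _ (enorm_ge0 (y - z)).
have dy := dot_ge0 y; have dz := dot_ge0 z.
have dyz : 0 <= eps * (dot y y + dot z z) by rewrite mulr_ge0 ?addr_ge0 // ltW.
have yz : y != z.
  by apply/eqP => yz; move: G0; rewrite yz in ph dyz *; rewrite /gap in gap0 epsN *; lra.
exists eps, y, z; set r := enorm (y - z); set e := r^-1 *: (y - z).
have jy := jet2B (jw y) (jet2Z eps (jet2_sqr 0 y)).
have jz := jet2D (jw z) (jet2Z eps (jet2_sqr 0 z)).
have r0 : 0 < r by rewrite enorm_gt0 subr_eq0.
have [|qy qz tr] := two_point_max yz jy jz (jphi r r0).
  move=> xi eta; exists 1 => // t _.
  by have := Gmax (y + t *: xi) (z + t *: eta); rewrite /G /= !subr0 -/r; lra.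
split=> //.
- by rewrite /gap in gap0 epsN G0 *; lra.
- move: qy; rewrite subr0 scalerA => /eqP; rewrite subr_eq => /eqP ->.
  by rewrite (mulrC 2).
- move: qz; rewrite subr0 scalerA => /eqP; rewrite -subr_eq0 => /eqP qz.
  apply/eqP; rewrite -subr_eq0 -qz; apply/eqP.
  by rewrite opprB (mulrC 2) addrA addrAC.
- move=> l A B; have := tr l A B.
  have -> : Hw z + eps *: 2%:M = Hw z - (- eps) *: 2%:M by rewrite scaleNr opprK.
  by rewrite !mxtrace_sub_scalar -/r -/e; lra.
Qed.

(** The second-order inequality at a doubled maximum, read along the coupling of
    two elliptic matrices. *)
Lemma coupled_trace_le k (a b X X' : 'M[R]_k) (y z : 'cV[R]_k) th L T f1 f2 c1 c2
    (r := enorm (y - z)) (e := r^-1 *: (y - z)) :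
  0 < th -> elliptic th a -> elliptic th b -> y != z -> 0 < L ->
  fro2 (a - b) <= (L * r) ^+ 2 -> fro2 a <= T -> fro2 b <= T ->
  0 <= f1 -> f2 <= 0 -> 0 <= c1 -> 0 <= c2 ->
  (forall l (A B : 'M[R]_(k, l)), \tr (A *m A^T *m X) - \tr (B *m B^T *m X') <=
     2 * f2 * enorm ((A - B)^T *m e) ^+ 2
     + f1 / r * (fro2 (A - B) - enorm ((A - B)^T *m e) ^+ 2)
     + c1 * fro2 A + c2 * fro2 B) ->
  \tr (a *m a^T *m X) - \tr (b *m b^T *m X') <=
    2 * f2 * th + f1 * coupling_cost th L T + (c1 + c2) * T.
Proof.
move=> th0 ha hb yz L0 hab aT bT f10 f20 c10 c20 h.
have yz0 : y - z != 0 by rewrite subr_eq0.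
have r0 : 0 < r by rewrite enorm_gt0.
have [l [A [B [hA hB hth hcost]]]] :=
  coupling th0 ha hb (enorm_unit yz0) r0 L0 hab aT bT.
have := h l A B; rewrite /fro2 hA hB -!/(fro2 _) => h1.
have h2 : f2 * enorm ((A - B)^T *m e) ^+ 2 <= f2 * th by rewrite ler_wnM2l.
have h3 : f1 / r * (fro2 (A - B) - enorm ((A - B)^T *m e) ^+ 2) <=
    f1 / r * (coupling_cost th L T * r).
  by rewrite ler_wpM2l // divr_ge0 // ltW.
have h4 : f1 / r * (coupling_cost th L T * r) = f1 * coupling_cost th L T.
  by field; rewrite gt_eqF.
have h5 : c1 * fro2 a <= c1 * T by rewrite ler_wpM2l.
have h6 : c2 * fro2 b <= c2 * T by rewrite ler_wpM2l.
rewrite h4 in h3; lra.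
Qed.

End Doubling.

(** * The linear equation *)

Section Linear.
Context {R : realType}.

Definition diffusion_bounds m (tau : 'cV[R]_m -> 'M[R]_m) (th L T : R) :=
  [/\ forall y, elliptic th (tau y),
      forall y z, fro2 (tau y - tau z) <= (L * enorm (y - z)) ^+ 2 &
      forall y, fro2 (tau y) <= T].

(** The consequence of the form of the drift at infinity: it stays within a
    bounded distance of an Ornstein-Uhlenbeck drift. *)
Definition reverting m (b : 'cV[R]_m -> 'cV[R]_m) binf (K : R) :=
  forall y, enorm (b y - (binf - y)) <= K.

Lemma reverting_ge0 m (b : 'cV[R]_m -> 'cV[R]_m) binf K : reverting b binf K -> 0 <= K.
Proof. by move=> /(_ 0); exact: le_trans (enorm_ge0 _). Qed.

Lemma reverting_sub m (b : 'cV[R]_m -> 'cV[R]_m) binf K y z :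
  reverting b binf K -> y != z ->
  dot (b y - b z) ((enorm (y - z))^-1 *: (y - z)) <= 2 * K - enorm (y - z).
Proof.
move=> hb; rewrite -subr_eq0 => yz.
have e1 := enorm_unit yz; set e := _ *: _ in e1 *.
have -> : b y - b z =
    (b y - (binf - y)) - (b z - (binf - z)) - enorm (y - z) *: e.
  rewrite enormZ_unit !opprB !addrA; apply/matrixP => i j; rewrite !mxE; ring.
have h1 := dot_le (b y - (binf - y)) e; have h2 := hb y.
have h3 := normr_dot_le (b z - (binf - z)) e; have h4 := hb z.
move: h1 h2 h3 h4; set d1 := b y - _; set d2 := b z - _ => h1 h2 h3 h4.
have -> : dot (d1 - d2 - enorm (y - z) *: e) e =
    dot d1 e - dot d2 e - enorm (y - z) * (dot e e).
  by rewrite 2!dotBl dotZl.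
rewrite -[dot e e]enorm_sqr e1 expr1n mulr1.
rewrite e1 mulr1 in h1; rewrite e1 mulr1 ler_norml in h3.
by move/andP: h3 => [h3 _]; lra.
Qed.

Lemma reverting_dot m (b : 'cV[R]_m -> 'cV[R]_m) binf K y :
  reverting b binf K -> dot (b y) y <= (K + enorm binf) ^+ 2 - dot y y / 2.
Proof.
move=> hb.
have -> : b y = (b y - (binf - y)) + binf - y.
  by apply/matrixP => i j; rewrite !mxE; ring.
have h1 := dot_le (b y - (binf - y)) y; have h2 := dot_le binf y.
have h3 : enorm (b y - (binf - y)) * enorm y <= K * enorm y.
  by rewrite ler_wpM2r ?enorm_ge0.
move: h1 h3; set d := b y - _ => h1 h3.
rewrite (dotBl (d + binf)) (dotDl d) -enorm_sqr.
have := sqr_ge0 (enorm y - (K + enorm binf)); rewrite sqrrB.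
have := sqr_ge0 (K + enorm binf); lra.
Qed.

Definition exp_profile (c a lam r : R) := c * r + c * a / lam * (1 - expR (- lam * r)).

Lemma exp_profile_continuous c a lam : continuous (exp_profile c a lam).
Proof.
apply: continuous_addr; first by apply: continuous_scaler => x; exact: cvg_id.
apply: continuous_scaler; apply: continuous_subr; first by move=> x; exact: cvg_cst.
move=> x; apply: (@continuous_comp _ _ _ (fun r => - lam * r) expR).
  by apply: continuous_scaler => {}x; exact: cvg_id.
exact: continuous_expR.
Qed.

Lemma exp_profile_expands (c a lam r : R) : lam != 0 ->
  expands2 (fun s => exp_profile c a lam (r + s)) (exp_profile c a lam r)
    (c * (1 + a * expR (- lam * r))) (- (c * a * lam * expR (- lam * r) / 2)).
Proof.
move=> lam0.
have hl : expands2 (fun s => - lam * r - lam * s) (- lam * r) (- lam) 0.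
  by apply: expands2_poly => s; ring.
have hc : expands2 (fun s => c * (r + s) + c * a / lam)
    (c * r + c * a / lam) c 0.
  by apply: expands2_poly => s; ring.
have := expands2B hc (expands2Z (c * a / lam) (expands2_comp hl (expands2_expR (- lam * r)))).
apply: expands2_eq => [s|||]; rewrite /exp_profile /=.
- by rewrite (_ : - lam * (r + s) = - lam * r - lam * s); ring.
- by ring.
- by field.
- by field.
Qed.

Lemma exp_profile_bounds (c a lam r : R) : 0 <= c -> 0 <= a -> 0 < lam -> 0 <= r ->
  c * r <= exp_profile c a lam r <= c * (1 + a) * r.
Proof.
move=> c0 a0 lam0 r0; rewrite /exp_profile.
have k0 : 0 <= c * a / lam by rewrite divr_ge0 ?mulr_ge0 // ltW.
have h1 : 0 <= c * a / lam * (1 - expR (- lam * r)).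
  by rewrite mulr_ge0 // subr_ge0 -expR0 ler_expR mulNr oppr_le0 mulr_ge0 // ltW.
have h2 : c * a / lam * (1 - expR (- lam * r)) <= c * a / lam * (lam * r).
  by rewrite ler_wpM2l //; have := expR_ge1Dx (- lam * r); lra.
have h3 : c * a / lam * (lam * r) = c * a * r by field; rewrite gt_eqF.
by apply/andP; split; lra.
Qed.

(** For bounded solutions of the linear equation the coupled drift contracts large
    distances, while at bounded distances ellipticity is available; the exponential
    profile, strictly concave where only ellipticity helps and linear
    at infinity, is a strict supersolution of the resulting one-dimensional
    inequality. *)
Lemma linear_equation_lipschitz m (th L T K F : R) (binf : 'cV[R]_m) :
  0 < th -> 0 < L -> 0 <= T -> 0 <= F ->
  exists2 C : R, 0 < C & forall tau b f w gw Hw delta W,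
    diffusion_bounds tau th L T -> reverting b binf K ->
    (forall y, 0 <= f y <= F) -> 0 < delta ->
    continuous w -> (forall y, jet2 w y (gw y) (Hw y)) -> (forall y, `|w y| <= W) ->
    (forall y, delta * w y - \tr (tau y *m (tau y)^T *m Hw y)
       - dot (b y) (gw y) - f y = 0) ->
    forall y z, w y - w z <= C * enorm (y - z).
Proof.
move=> th0 L0 T0 F0.
pose kc := coupling_cost th L T.
have kc0 : 0 <= kc.
  by rewrite addr_ge0 ?divr_ge0 ?mulr_ge0 ?sqrtr_ge0 ?(ltW L0).
(* [k] bounds the outward push of coupling and drift at every distance.  With
   [lam * th = k + 1] concavity beats it as long as [a * expR (- lam * r) >= k + 1],
   that is for [r <= k + 1]; beyond this radius the inward drift alone wins, and
   the slope [c] at infinity absorbs the source. *)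
pose k : R := kc + 2 * `|K|.
have k0 : 0 <= k by rewrite addr_ge0 // mulr_ge0.
pose c : R := 2 * F + 1; have c0 : 0 < c by rewrite /c; lra.
pose lam : R := (k + 1) / th; have lam0 : 0 < lam by rewrite divr_gt0 //; lra.
pose a : R := (k + 1) * expR (lam * (k + 1)).
have a0 : 0 < a by rewrite mulr_gt0 ?expR_gt0 //; lra.
exists (c * (1 + a)); first by rewrite mulr_gt0 // addr_gt0.
move=> tau b f w gw Hw delta W [ell lip bnd] hb hf delta0 cw jw bw eqw y0 z0.
have K0 := reverting_ge0 hb; have kE : k = kc + 2 * K by rewrite /k ger0_norm.
rewrite leNgt; apply/negP => h0.
have ph0 (r : R) : 0 <= r -> 0 <= exp_profile c a lam r.
  move=> r0; have /andP[h _] := exp_profile_bounds (ltW c0) (ltW a0) lam0 r0.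
  by apply: le_trans h; rewrite mulr_ge0 // ltW.
have {}h0 : exp_profile c a lam (enorm (y0 - z0)) < w y0 - w z0.
  have /andP[_ h] := exp_profile_bounds (ltW c0) (ltW a0) lam0 (enorm_ge0 (y0 - z0)).
  exact: le_lt_trans h h0.
have ph00 : exp_profile c a lam 0 = 0.
  by rewrite /exp_profile !mulr0 expR0 subrr mulr0 addr0.
have jphi (r : R) : 0 < r -> expands2 (fun s => exp_profile c a lam (r + s))
    (exp_profile c a lam r) (c * (1 + a * expR (- lam * r)))
    (- (c * a * lam * expR (- lam * r) / 2)).
  by move=> _; apply: exp_profile_expands; rewrite gt_eqF.
have [eta eta0 H] :=
  doubling cw jw bw (@exp_profile_continuous c a lam) ph00 ph0 jphi h0.
pose D := (K + enorm binf) ^+ 2; have D0 : 0 <= D := sqr_ge0 _.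
have Q0 : 0 < 4 * T + 4 * D + 1 by lra.
have [eps [y [z [[eps0 eps1 yz] hgap gy gz htr]]]] :=
  H _ (divr_gt0 (mulr_gt0 delta0 eta0) Q0).
rewrite ltr_pdivlMr // in eps1.
move: gy gz htr; set r := enorm (y - z); set e := r^-1 *: (y - z).
set E := expR _ => gy gz htr.
have E0 : 0 < E := expR_gt0 _.
have r0 : 0 < r by rewrite enorm_gt0 subr_eq0.
have htr' : \tr (tau y *m (tau y)^T *m Hw y) - \tr (tau z *m (tau z)^T *m Hw z) <=
    2 * (- (c * a * lam * E / 2)) * th + c * (1 + a * E) * kc + (2 * eps + 2 * eps) * T.
  apply: (@coupled_trace_le _ _ (tau y) (tau z) _ _ y z) => //.
  - by rewrite mulr_ge0 ?(ltW c0) // addr_ge0 // mulr_ge0 // ltW.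
  - rewrite oppr_le0 divr_ge0 //.
    exact: mulr_ge0 (mulr_ge0 (mulr_ge0 (ltW c0) (ltW a0)) (ltW lam0)) (ltW E0).
  - by rewrite mulr_ge0 // ltW.
  - by rewrite mulr_ge0 // ltW.
  - by move=> l A B; have := htr l A B; rewrite -/r -/e; lra.
have eqy := eqw y; have eqz := eqw z.
have f1 : 0 <= c * (1 + a * E) by rewrite mulr_ge0 ?(ltW c0) // addr_ge0 // mulr_ge0 // ltW.
have hdrift : dot (b y) (gw y) - dot (b z) (gw z) <=
    c * (1 + a * E) * (2 * K - r) + 4 * eps * D.
  have -> : dot (b y) (gw y) - dot (b z) (gw z) =
      c * (1 + a * E) * dot (b y - b z) e + 2 * eps * (dot (b y) y + dot (b z) z).
    by rewrite gy gz !dotDE; ring.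
  have h1 : c * (1 + a * E) * dot (b y - b z) e <= c * (1 + a * E) * (2 * K - r).
    by rewrite ler_wpM2l //; exact: reverting_sub.
  have h2 : 2 * eps * (dot (b y) y + dot (b z) z) <= 2 * eps * (2 * D).
    rewrite ler_wpM2l ?mulr_ge0 ?(ltW eps0) //.
    have := reverting_dot y hb; have := reverting_dot z hb.
    have := dot_ge0 y; have := dot_ge0 z; rewrite -/D; lra.
  lra.
have /andP[fy0 fy1] := hf y; have /andP[fz0 fz1] := hf z.
have hdel : delta * eta <= delta * (w y - w z).
  rewrite ler_wpM2l ?(ltW delta0) //.
  have : 0 <= eps * (dot y y + dot z z) by rewrite mulr_ge0 ?addr_ge0 ?dot_ge0 // ltW.
  lra.
have key : c * (1 + a * E) * (k - r) - c * a * lam * E * th + 2 * F <= 0.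
  have aE0 : 0 <= a * E by rewrite mulr_ge0 // ltW.
  have -> : c * a * lam * E * th = c * (a * E) * (k + 1) by rewrite /lam; field; rewrite gt_eqF.
  have [rk|rk] := leP r (k + 1).
    have aE : k + 1 <= a * E.
      have hx : 0 <= lam * (k + 1) + - lam * r.
        by rewrite mulNr subr_ge0 ler_wpM2l // ltW.
      rewrite /a /E -mulrA -expRD -[leLHS]mulr1 ler_wpM2l //; first by lra.
      by apply: le_trans (expR_ge1Dx _); lra.
    have h : c * (1 + a * E) * (k - r) <= c * (1 + a * E) * k.
      by rewrite ler_wpM2l //; lra.
    have h2 : c * (k + 1) <= c * (a * E) by rewrite ler_wpM2l // (ltW c0).
    by rewrite /c in h h2 *; lra.
  have h : c * (1 + a * E) * (k - r) <= c * (1 + a * E) * (- 1).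
    by rewrite ler_wpM2l //; lra.
  have h2 : 0 <= c * (a * E) * (k + 1) by rewrite mulr_ge0 // ?mulr_ge0 // ?(ltW c0) //; lra.
  have h3 : 0 <= c * (a * E) by rewrite mulr_ge0 // (ltW c0).
  by rewrite /c in h h2 h3 *; lra.
rewrite kE in key; lra.
Qed.

End Linear.

(** * Interior estimates for linear inequalities *)

Section Interior.
Context {R : realType}.

(** The quadratic profile is concave enough for ellipticity to beat, on a ball of
    radius [rho <= 1], the drift, the right-hand side and the localizing term
    [kappa |y - y0|^2], all of which are at worst of order [V / rho ^+ 2].  The
    right-hand side enters through its size only, so that it may later contain
    the unknown function itself. *)
Lemma interior_lipschitz m (th L T K c : R) :
  0 < th -> 0 < L -> 0 <= T -> 0 <= K -> 0 <= c ->
  exists2 s : R, 0 < s <= 1 / 2 &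
    forall tau (beta : 'cV[R]_m -> 'cV[R]_m) (v : 'cV[R]_m -> R) gv Hv y0 (rho V : R),
    diffusion_bounds tau th L T -> 0 < rho <= 1 ->
    continuous v -> (forall y, jet2 v y (gv y) (Hv y)) ->
    (forall y, enorm (y - y0) <= rho -> [/\ 0 <= v y <= V, enorm (beta y) <= K &
       `|\tr (tau y *m (tau y)^T *m Hv y) + dot (beta y) (gv y)| <= c * V]) ->
    forall z, enorm (z - y0) <= s * rho ->
      v y0 - v z <= 2 * V / (s * rho) * enorm (y0 - z).
Proof.
move=> th0 L0 T0 K0 c0; pose kc := coupling_cost th L T.
have kc0 : 0 <= kc by rewrite addr_ge0 ?divr_ge0 ?mulr_ge0 ?sqrtr_ge0 ?(ltW L0).
(* [Q] collects the terms against which concavity, of order [th / s], competes *)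
pose Q : R := kc + 2 * K + 4 * T + 4 * K + c.
have Q0 : 0 <= Q by rewrite /Q; lra.
have d0 : 0 < 2 * th + Q + 1 by lra.
pose s : R := th / (2 * th + Q + 1).
have s0 : 0 < s by rewrite divr_gt0.
have s2 : s <= 1 / 2 by rewrite ler_pdivrMr //; lra.
have sQ : s * Q < th.
  have -> : s * Q = th * (Q / (2 * th + Q + 1)) by rewrite /s; field; rewrite gt_eqF.
  by rewrite -[ltRHS]mulr1 ltr_pM2l // ltr_pdivrMr //; lra.
exists s; first by rewrite s0.
move=> tau beta v gv Hv y0 rho V [ell lip bnd] /andP[rho0 rho1] cv jv hB z0 z0s.
rewrite leNgt; apply/negP => h0.
pose r1 := s * rho; have r10 : 0 < r1 by rewrite mulr_gt0.
have r1rho : r1 <= rho / 2 by rewrite /r1 mulrC -[_ / 2](mulr1) -mulrA ler_wpM2l ?(ltW rho0) //; lra.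
have z0B : enorm (z0 - y0) <= rho by apply: le_trans z0s _; rewrite -/r1; lra.
have y0B : enorm (y0 - y0) <= rho by rewrite subrr enorm0 ltW.
have V0 : 0 < V.
  have [/andP[a1 a2] _ _] := hB _ y0B; have [/andP[a3 a4] _ _] := hB _ z0B.
  rewrite ltNge; apply/negP => V0.
  have V00 : V = 0 by lra.
  by move: h0; rewrite V00 mulr0 !mul0r; lra.
pose l : R := 2 * V / r1; have l0 : 0 < l by apply: divr_gt0 => //; apply: mulr_gt0.
have two0 : 0 < 2 :> R by [].
have lr10 : 0 < l / (2 * r1) := divr_gt0 l0 (mulr_gt0 two0 r10).
pose kappa : R := 4 * V / rho ^+ 2.
have kappa0 : 0 < kappa by rewrite divr_gt0 ?mulr_gt0 ?exprn_gt0.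
pose phi (r : R) := l * r - l / (2 * r1) * r ^+ 2.
have phi_r1 : phi r1 = V by rewrite /phi /l; field; rewrite gt_eqF.
have cphi : continuous phi.
  apply: continuous_subr; first by apply: continuous_scaler => x; exact: cvg_id.
  by apply: continuous_scaler; apply: continuous_mulr => x; exact: cvg_id.
have jphi (r : R) : expands2 (fun s => phi (r + s)) (phi r)
    (l * (1 - r / r1)) (- (l / (2 * r1))).
  by apply: expands2_poly => t; rewrite /phi; field; rewrite gt_eqF.
pose G (p : 'cV[R]_m * 'cV[R]_m) := v p.1 - v p.2 - phi (enorm (p.1 - p.2)) -
  kappa * dot (p.1 - y0) (p.1 - y0).
have cG : continuous G.
  rewrite /G; apply: continuous_subr; last first.
    apply: continuous_scaler.
    exact: (@continuous_fst_comp _ _ _ _ (@dot_sub_continuous _ _ y0)).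
  apply: continuous_subr; last first.
    move=> p; apply: (@continuous_comp _ _ _ (fun p : 'cV[R]_m * 'cV[R]_m => enorm (p.1 - p.2)) phi).
      exact: enorm_sub_continuous.
    exact: cphi.
  apply: continuous_subr.
    exact: (@continuous_fst_comp _ _ _ _ cv).
  exact: (@continuous_snd_comp _ _ _ _ cv).
(* [kappa] and [l] are such that the penalizations reach [V], an upper bound of
   the oscillation, on the boundary of this set: the maximum is interior *)
pose S := ([set y : 'cV[R]_m | enorm (y - y0) <= rho / 2] `*`
           [set y : 'cV[R]_m | enorm (y - y0) <= rho]) `&`
          [set p | enorm (p.1 - p.2) <= r1].
have cS : compact S.
  apply: compact_closedI; first by apply: compact_setX; exact: compact_eball.
  exact: (continuous_closedP _).1 (@enorm_sub_continuous R m) _ (@closed_le R r1).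
have S0 : S (y0, z0).
  by split; [split=> //=; rewrite subrr enorm0 divr_ge0 // ltW|rewrite /= enormC].
have [[y z] [[/= yB zB] yz1] Smax] := compact_max S0 cS cG.
have G0 : 0 < G (y0, z0).
  rewrite /G /= subrr dot0l mulr0 subr0 /phi subr_gt0.
  have : 0 <= l / (2 * r1) * enorm (y0 - z0) ^+ 2.
    exact: mulr_ge0 (ltW lr10) (sqr_ge0 _).
  by move: h0; rewrite -/r1 -/l; lra.
have := lt_le_trans G0 (Smax _ S0); rewrite /G /=; set r := enorm (y - z) => Gpos.
have yB' : enorm (y - y0) <= rho by clear - yB rho0; lra.
have [/andP[vy0 vyV] by_ eqy] := hB _ yB'.
have [/andP[vz0 vzV] bz eqz] := hB _ zB.
have r_ge0 : 0 <= r := enorm_ge0 _.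
have phi_ge0 : l * r / 2 <= phi r.
  rewrite /phi expr2 mulrA.
  have : l / (2 * r1) * r * r <= l / (2 * r1) * r * r1.
    by apply: ler_wpM2l; first exact: mulr_ge0 (ltW lr10) r_ge0.
  have -> : l / (2 * r1) * r * r1 = l * r / 2 by field; rewrite gt_eqF.
  by clear; lra.
have lr0 : 0 <= l * r by rewrite mulr_ge0 // ltW.
have kd0 : 0 <= kappa * dot (y - y0) (y - y0) by rewrite mulr_ge0 ?dot_ge0 // ltW.
have ylt : enorm (y - y0) < rho / 2.
  rewrite lt_neqAle yB andbT; apply/eqP => yE.
  have : kappa * dot (y - y0) (y - y0) = V.
    by rewrite -enorm_sqr yE /kappa; field; rewrite gt_eqF.
  by clear - Gpos phi_ge0 lr0 vz0 vyV; lra.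
have rlt : r < r1.
  rewrite lt_neqAle yz1 andbT; apply/eqP => rE.
  move: Gpos; rewrite rE phi_r1.
  by clear - kd0 vz0 vyV; lra.
have yz : y != z.
  apply/eqP => yzE; move: Gpos kd0; rewrite yzE subrr.
  by clear - phi_ge0 lr0; lra.
have jy := jet2B (jv y) (jet2Z kappa (jet2_sqr y0 y)).
have [|qy qz tr] := two_point_max yz jy (jv z) (jphi r).
  move=> xi eta.
  have n1 : 0 < enorm xi + 1 by rewrite ltr_wpDl ?enorm_ge0.
  have n2 : 0 < enorm (xi - eta) + 1 by rewrite ltr_wpDl ?enorm_ge0.
  exists (Num.min ((rho / 2 - enorm (y - y0)) / (enorm xi + 1))
                  ((r1 - r) / (enorm (xi - eta) + 1))).
    by rewrite lt_min !divr_gt0 // subr_gt0.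
  move=> t; rewrite lt_min !ltr_pdivlMr // => /andP[t1 t2].
  have t0 := normr_ge0 t.
  have m1 : enorm (y + t *: xi - y0) <= rho / 2.
    rewrite addrAC; apply: le_trans (enormD _ _) _; rewrite enormZ.
    by clear - t1 t0; lra.
  have m2 : enorm (y + t *: xi - (z + t *: eta)) <= r1.
    rewrite opprD addrACA -scalerBr; apply: le_trans (enormD _ _) _.
    by rewrite enormZ -/r; clear - t2 t0; lra.
  have m3 : enorm (z + t *: eta - y0) <= rho.
    rewrite (_ : _ - y0 = (y + t *: xi - y0) - (y + t *: xi - (z + t *: eta))).
      by apply: le_trans (enormB _ _) _; clear - m1 m2 r1rho; lra.
    by apply/matrixP => i j; rewrite !mxE; ring.
  have := Smax (y + t *: xi, z + t *: eta) (conj (conj m1 m3) m2).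
  by rewrite /G /= -/r; clear; lra.
rewrite -/r in qy qz tr; set e := r^-1 *: (y - z) in qy qz tr.
have r0 : 0 < r by rewrite enorm_gt0 subr_eq0.
have e1 : enorm e = 1 by rewrite enorm_unit // subr_eq0.
have {}qy : gv y = (l * (1 - r / r1)) *: e + (2 * kappa) *: (y - y0).
  by move/eqP: qy; rewrite subr_eq scalerA (mulrC 2) => /eqP.
set p := l * (1 - r / r1) in qy qz tr.
have p0 : 0 <= p.
  by rewrite mulr_ge0 ?(ltW l0) // subr_ge0 ler_pdivrMr // mul1r ltW.
have pl : p <= l.
  by rewrite /p -[leRHS]mulr1 ler_wpM2l ?(ltW l0) // gerBl divr_ge0 // ltW.
have htr : \tr (tau y *m (tau y)^T *m Hv y) - \tr (tau z *m (tau z)^T *m Hv z) <=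
    2 * (- (l / (2 * r1))) * th + p * kc + (2 * kappa + 0) * T.
  apply: (@coupled_trace_le _ _ (tau y) (tau z) _ _ y z) => //.
  - by rewrite oppr_le0 ltW.
  - by rewrite mulr_ge0 // ltW.
  - move=> k A B; have := tr k A B.
    by rewrite mxtrace_sub_scalar -/r -/e; clear; lra.
have hdy : dot (beta y) (gv y) <= p * K + 2 * kappa * (K * 1) .
  rewrite qy dotDr (dotZr p) (dotZr (2 * kappa)); apply: lerD.
    rewrite ler_wpM2l //; apply: le_trans (dot_le _ _) _.
    by rewrite e1 mulr1.
  apply: ler_wpM2l; first exact: mulr_ge0 (ltW two0) (ltW kappa0).
  apply: le_trans (dot_le _ _) _; rewrite ler_pM ?enorm_ge0 //.
  exact: le_trans yB' rho1.
have hdz : - (p * K) <= dot (beta z) (gv z).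
  rewrite qz (dotZr p) -mulrN ler_wpM2l //.
  have := normr_dot_le (beta z) e; rewrite e1 mulr1 ler_norml => /andP[h _].
  by clear - h bz; lra.
move: eqy eqz; rewrite !ler_norml => /andP[eqy _] /andP[_ eqz].
have kK0 : 0 <= kc + 2 * K := addr_ge0 kc0 (mulr_ge0 (ltW two0) K0).
have plk : p * (kc + 2 * K) <= l * (kc + 2 * K) by apply: ler_wpM2r.
pose q := V / rho ^+ 2; have q0 : 0 < q by rewrite divr_gt0 ?exprn_gt0.
have E1 : l / (2 * r1) * th * 2 = 2 * q * (th / s ^+ 2).
  by rewrite /l /q /r1; field; rewrite ?gt_eqF //; rewrite ?(gt_eqF rho0) ?(gt_eqF s0).
have E2 : l <= 2 * q / s.
  have -> : l = 2 * q / s * rho.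
    by rewrite /l /q /r1; field; rewrite ?(gt_eqF rho0) ?(gt_eqF s0).
  rewrite -[leRHS]mulr1; apply: ler_wpM2l => //.
  exact: divr_ge0 (mulr_ge0 (ltW two0) (ltW q0)) (ltW s0).
have E3 : kappa = 4 * q by rewrite /kappa /q mulrA.
have E4 : V <= q.
  by rewrite /q ler_pdivlMr ?exprn_gt0 // -[leRHS]mulr1 ler_wpM2l ?(ltW V0) // expr_le1 // ltW.
have E5 : q <= q / s.
  rewrite ler_pdivlMr // -[leRHS]mulr1 ler_wpM2l ?(ltW q0) //.
  by clear - s2; lra.
have X1 : l * (kc + 2 * K) <= 2 * q / s * (kc + 2 * K) by apply: ler_wpM2r.
have X2 : c * V <= c * (q / s) := ler_wpM2l c0 (le_trans E4 E5).
have X3 : q * T <= q / s * T by rewrite ler_wpM2r.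
have X4 : q * K <= q / s * K by rewrite ler_wpM2r.
have : 2 * q * (th / s ^+ 2) <= 2 * (q / s) * Q.
  rewrite -E1 /Q; rewrite E3 in htr hdy.
  by clear - htr hdy hdz eqy eqz plk X1 X2 X3 X4; lra.
have -> : 2 * q * (th / s ^+ 2) = 2 * (q / s) * (th / s) by field; rewrite gt_eqF.
rewrite (ler_pM2l (mulr_gt0 two0 (divr_gt0 q0 s0))) (ler_pdivrMr _ _ s0) mulrC.
by rewrite leNgt sQ.
Qed.

End Interior.

(** * Harnack inequality *)

Section Harnack.
Context {R : realType}.

Lemma mxtrace_radial k l (A : 'M[R]_(k, l)) X (x : 'cV[R]_k) (f1 f2 : R) :
  \tr (A *m A^T *m (f1 *: 2%:M + (2 * f2) *: ((2 *: x) *m (2 *: x)^T) - X)) =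
  2 * f1 * fro2 A + 8 * f2 * enorm (A^T *m x) ^+ 2 - \tr (A *m A^T *m X).
Proof.
have h1 : \tr (A *m A^T *m (f1 *: 2%:M)) = 2 * f1 * fro2 A.
  by rewrite -scalemxAr mul_mx_scalar !linearZ /= -/(fro2 A) mulrA (mulrC f1).
have h2 : \tr (A *m A^T *m ((2 * f2) *: ((2 *: x) *m (2 *: x)^T))) =
    8 * f2 * enorm (A^T *m x) ^+ 2.
  rewrite -scalemxAr linearZ /= mulmxA mxtrace_outer -mulmxA dot_mull -enorm_sqr.
  by rewrite -scalemxAr enormZ ger0_norm // exprMn; ring.
by rewrite mulmxBr mulmxDr linearB linearD /= h1 h2.
Qed.

(** A negative power of the distance to [y0] is a subsolution away from [y0]
    once the exponent is large compared with the ellipticity, so a lower bound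
    on a small sphere propagates outwards with polynomial loss. *)
Lemma power_barrier m (th T K c : R) : 0 < th -> 0 <= T -> 0 <= K -> 0 <= c ->
  exists2 j : nat, (0 < j)%N &
    forall tau (beta : 'cV[R]_m -> 'cV[R]_m) (v : 'cV[R]_m -> R) gv Hv y0 (r0 mu : R),
    (forall y, elliptic th (tau y)) -> (forall y, fro2 (tau y) <= T) ->
    0 < r0 -> r0 <= 2 -> 0 < mu ->
    continuous v -> (forall y, jet2 v y (gv y) (Hv y)) -> (forall y, 0 < v y) ->
    (forall y, enorm (y - y0) <= 2 -> enorm (beta y) <= K /\
       \tr (tau y *m (tau y)^T *m Hv y) + dot (beta y) (gv y) <= c * v y) ->
    (forall y, enorm (y - y0) <= r0 -> mu <= v y) ->
    forall x, r0 <= enorm (x - y0) <= 2 ->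
      mu * (r0 ^+ 2) ^+ j * ((dot (x - y0) (x - y0))^-1 ^+ j - 4^-1 ^+ j) <= v x.
Proof.
move=> th0 T0 K0 c0.
(* large enough for the radial second derivative to beat all the other terms on
   a ball of radius 2, where the squared distance is at most 4 *)
have [j j0 jth] : exists2 j, (0 < j)%N & 2 * T + 4 * K + 4 * c < 4 * th * j%:R.
  exists (Num.truncn ((2 * T + 4 * K + 4 * c) / (4 * th))).+1 => //.
  rewrite [ltRHS]mulrC -ltr_pdivrMr ?mulr_gt0 //.
  have h : 0 <= (2 * T + 4 * K + 4 * c) / (4 * th).
    by rewrite divr_ge0 ?addr_ge0 ?mulr_ge0 // ltW.
  by have /andP[_] := truncn_itv h.
exists j => // tau beta v gv Hv y0 r0 mu ell bnd r00 r02 mu0 cv jv v0 hB hmu x xB.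
have r20 : 0 < r0 ^+ 2 by rewrite exprn_gt0.
pose ga : R := mu * (r0 ^+ 2) ^+ j.
have ga0 : 0 < ga by rewrite mulr_gt0 // exprn_gt0.
pose F (s : R) := ga * (s^-1 ^+ j - 4^-1 ^+ j).
pose S (y : 'cV[R]_m) := dot (y - y0) (y - y0).
pose A := [set y : 'cV[R]_m | enorm (y - y0) <= 2] `&` [set y | - enorm (y - y0) <= - r0].
have cN : continuous (fun y : 'cV[R]_m => - enorm (y - y0)).
  move=> y; apply: (@cvgN _ _ _ (nbhs y) _ (fun y => enorm (y - y0))).
  exact: enorm_subl_continuous.
have cA : compact A.
  apply: compact_closedI; first exact: compact_eball.
  exact: (continuous_closedP _).1 cN _ (@closed_le R (- r0)).
have Ax : A x by move/andP: xB => [x1 x2]; split=> //=; rewrite lerN2.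
have Spos (y : 'cV[R]_m) : r0 <= enorm (y - y0) -> 0 < S y.
  by move=> h; rewrite /S -enorm_sqr exprn_gt0 // (lt_le_trans r00 h).
have cF (s : R) : s != 0 -> {for s, continuous F}.
  move=> s0; apply: (@continuousM R R (cst ga)); first exact: cst_continuous.
  apply: (@continuousB R R^o R (fun s => s^-1 ^+ j) (cst (4^-1 ^+ j))); last exact: cst_continuous.
  apply: (@continuous_comp _ _ _ (fun s : R => s^-1) (fun s : R => s ^+ j)).
    exact: inv_continuous.
  exact: exprn_continuous.
pose G y := F (S y) - v y.
have cG y : A y -> {for y, continuous G}.
  move=> [_ /=]; rewrite lerN2 => h.
  apply: (@cvgB R R _ (nbhs y) _ (F \o S) v); last exact: cv.
  apply: (@continuous_comp _ _ _ S F); first exact: dot_sub_continuous.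
  by apply: cF; rewrite gt_eqF // Spos.
have [p Ap pmax] := compact_max_at Ax cA cG.
suff : G p <= 0 by move=> h; have := le_trans (pmax _ Ax) h; rewrite subr_le0.
rewrite leNgt; apply/negP; rewrite /G subr_gt0 => Gp.
case: (Ap) => /= p2; rewrite lerN2 => pr0.
have Sp0 := Spos _ pr0; have vp := v0 p.
have pr0' : r0 < enorm (p - y0).
  rewrite lt_neqAle pr0 andbT; apply/eqP => pE.
  have h : mu <= v p by apply: hmu; rewrite pE.
  have : F (S p) <= mu.
    rewrite /F /S -enorm_sqr -pE mulrBr /ga exprVn -mulrA divff ?mulr1; last first.
      by rewrite expf_neq0 // gt_eqF.
    rewrite gerBl; apply: mulr_ge0; last by rewrite exprn_ge0 // invr_ge0.
    by rewrite mulr_ge0 ?(ltW mu0) // exprn_ge0 // ltW.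
  by clear - h Gp; lra.
have p2' : enorm (p - y0) < 2.
  rewrite lt_neqAle p2 andbT; apply/eqP => pE.
  move: Gp; rewrite /F /S -enorm_sqr pE (_ : 2 ^+ 2 = 4) ?subrr ?mulr0; last by ring.
  by clear - vp; lra.
pose i := (S p)^-1; have i0 : 0 < i by rewrite invr_gt0.
have hF : expands2 (fun s => F (S p + s)) (F (S p)) (ga * - (j%:R * i ^+ j.+1))
    (ga * (j%:R * j.+1%:R / 2 * i ^+ j.+2)).
  have hcst : expands2 (fun _ : R => 4^-1 ^+ j) (4^-1 ^+ j) 0 0.
    by apply: expands2_poly => t; ring.
  apply: expands2_eq (expands2Z ga (expands2B (expands2_powV j Sp0) hcst)) => //.
    by rewrite subr0.
  by rewrite subr0.
have jG := jet2B (jet2_comp (jet2_sqr y0 p) hF) (jv p).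
have [|q0 trG] := line_max jG.
  move=> xi; have n1 : 0 < enorm xi + 1 by rewrite ltr_wpDl ?enorm_ge0.
  exists (Num.min ((2 - enorm (p - y0)) / (enorm xi + 1))
                  ((enorm (p - y0) - r0) / (enorm xi + 1))).
    by rewrite lt_min !divr_gt0 // subr_gt0.
  move=> t; rewrite lt_min !ltr_pdivlMr // => /andP[t1 t2].
  have t0 := normr_ge0 t; apply: (pmax (p + t *: xi)); split=> /=.
    rewrite addrAC; apply: le_trans (enormD _ _) _; rewrite enormZ.
    by clear - t1 t0; lra.
  rewrite lerN2 addrAC; have := enorm_sub_le (p - y0) (- (t *: xi)).
  by rewrite opprK enormN enormZ; clear - t2 t0; lra.
have {trG} := trG m (tau p).
rewrite mxtrace_radial.
move/eqP: q0; rewrite subr_eq0 => /eqP q0.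
have [bp] := hB p p2; rewrite -q0 !dotZr => hlin htr.
pose P := ga * i ^+ j.+1; have P0 : 0 < P by rewrite mulr_gt0 // exprn_gt0.
have iS : i * S p = 1 by rewrite mulVf // gt_eqF.
have S4 : S p <= 4.
  rewrite /S -enorm_sqr (_ : 4 = 2 ^+ 2); last by ring.
  by rewrite ler_pXn2r ?nnegrE ?enorm_ge0.
have hb : dot (beta p) (p - y0) <= 2 * K.
  apply: le_trans (dot_le _ _) _; rewrite mulrC.
  by rewrite ler_pM ?enorm_ge0.
have jR : 1 <= j%:R :> R by rewrite ler1n.
have Pj0 : 0 <= P * j%:R by rewrite mulr_ge0 ?(ltW P0).
have hX : P * j%:R * j.+1%:R * i * (th * S p) <=
    P * j%:R * j.+1%:R * i * enorm ((tau p)^T *m (p - y0)) ^+ 2.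
  apply: ler_wpM2l; first exact: mulr_ge0 (mulr_ge0 Pj0 (ler0n _ _)) (ltW i0).
  by have := ell p (p - y0); rewrite enorm_sqr.
have hT : P * j%:R * fro2 (tau p) <= P * j%:R * T by rewrite ler_wpM2l.
have hK : P * j%:R * dot (beta p) (p - y0) <= P * j%:R * (2 * K) by rewrite ler_wpM2l.
have hF4 : F (S p) <= 4 * P.
  have -> : 4 * P = ga * i ^+ j * (i * 4) by rewrite /P exprS; ring.
  rewrite /F -/i mulrBr.
  have g1 : 0 <= ga * i ^+ j by rewrite mulr_ge0 ?(ltW ga0) // exprn_ge0 // ltW.
  have g2 : 0 <= ga * 4^-1 ^+ j by rewrite mulr_ge0 ?(ltW ga0) // exprn_ge0 // invr_ge0.
  have g3 : ga * i ^+ j * 1 <= ga * i ^+ j * (i * 4).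
    by apply: ler_wpM2l => //; rewrite -[leLHS]iS ler_wpM2l ?(ltW i0).
  by clear - g1 g2 g3; lra.
have hc : c * v p <= c * (4 * P).
  by apply: ler_wpM2l => //; exact: le_trans (ltW Gp) hF4.
have hX' : P * j%:R * j.+1%:R * i * (th * S p) = P * j%:R * j.+1%:R * th.
  by rewrite -[RHS]mulr1 -[X in _ = _ * X]iS; ring.
have hiX : 8 * (ga * (j%:R * j.+1%:R / 2 * i ^+ j.+2)) = 4 * (P * j%:R * j.+1%:R * i).
  by rewrite /P !exprS; field.
have hi1 : ga * - (j%:R * i ^+ j.+1) = - (P * j%:R) by rewrite /P; ring.
rewrite hiX hi1 in htr; rewrite hi1 in hlin.
have main : P * (j%:R * (4 * j.+1%:R * th - 2 * T - 4 * K)) <= P * (4 * c).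
  by rewrite hX' in hX; clear - htr hlin hX hT hK hc; lra.
rewrite (ler_pM2l P0) in main.
have j1 : j.+1%:R = j%:R + 1 :> R by rewrite natr1.
rewrite j1 in main.
have big : 4 * c < 4 * (j%:R + 1) * th - 2 * T - 4 * K.
  by clear - jth th0; lra.
have big0 : 0 <= 4 * (j%:R + 1) * th - 2 * T - 4 * K.
  by clear - big c0; lra.
have := ler_wpM2r big0 jR; rewrite mul1r.
by clear - main big; lra.
Qed.

(** The maximum [y0] of [v (1 - |y - x0|)^(2 j)] is a point around which, at the scale
    of its distance to the boundary, [v] is at most a multiple of [v y0]; the
    interior estimate keeps [v] above [v y0 / 2] on a ball of comparable radius,
    and the barrier carries this bound to [x0].  The weight and the barrier have
    the same exponent, hence the two powers of the distance cancel. *)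
Lemma harnack m (th L T K c : R) :
  0 < th -> 0 < L -> 0 <= T -> 0 <= K -> 0 <= c ->
  exists2 C : R, 0 < C &
    forall tau (beta : 'cV[R]_m -> 'cV[R]_m) (v : 'cV[R]_m -> R) gv Hv x0,
    diffusion_bounds tau th L T ->
    continuous v -> (forall y, jet2 v y (gv y) (Hv y)) -> (forall y, 0 < v y) ->
    (forall y, enorm (y - x0) <= 3 -> enorm (beta y) <= K /\
       `|\tr (tau y *m (tau y)^T *m Hv y) + dot (beta y) (gv y)| <= c * v y) ->
    forall y, enorm (y - x0) <= 1 / 2 -> v y <= C * v x0.
Proof.
move=> th0 L0 T0 K0 c0.
have [s /andP[s0 s2] hint] := interior_lipschitz m th0 L0 T0 K0 c0.
have [j j0 hbar] := power_barrier m th0 T0 K0 c0.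
have k0 : 0 < 4 ^+ j :> R by rewrite exprn_gt0.
have k1 : 1 <= 4 ^+ j :> R by rewrite exprn_ege1 // ler1n.
(* on the ball of radius [eps * d] around [y0] the interior estimate, applied with
   the bound [4 ^+ j * v y0], loses at most half of [v y0] *)
pose eps : R := s / (8 * 4 ^+ j).
have eps0 : 0 < eps by rewrite divr_gt0 // mulr_gt0.
have epsk : eps * (8 * 4 ^+ j) = s by rewrite divfK // gt_eqF // mulr_gt0.
have eps_s : eps * 8 <= s.
  rewrite -epsk; apply: ler_wpM2l; first exact: ltW.
  by clear - k1; lra.
pose e2j : R := (eps ^+ 2) ^+ j.
have e2j0 : 0 < e2j by rewrite !exprn_gt0.
pose C0 : R := 4^-1 ^+ j * (3 / 8) * e2j.
have C00 : 0 < C0 by rewrite mulr_gt0 // mulr_gt0 // exprn_gt0 // invr_gt0.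
exists C0^-1; first by rewrite invr_gt0.
move=> tau beta v gv Hv x0 diff cv jv v0 hB y yB.
pose D (y : 'cV[R]_m) : R := 1 - enorm (y - x0).
pose G y := v y * (D y ^+ 2) ^+ j.
have cD : continuous D.
  apply: (@continuous_subr R _ (fun=> 1)); first exact: cst_continuous.
  exact: enorm_subl_continuous.
have cG : continuous G.
  apply: continuous_mulr => // z.
  apply: (@continuous_comp _ _ _ (fun z => D z ^+ 2) (fun s : R => s ^+ j)).
    apply: (@continuous_comp _ _ _ D (fun s : R => s ^+ 2)); first exact: cD.
    exact: exprn_continuous.
  exact: exprn_continuous.
pose A := [set y : 'cV[R]_m | enorm (y - x0) <= 1].
have Ax0 : A x0 by rewrite /A /= subrr enorm0.
have [y0 Ay0 y0max] := compact_max Ax0 (@compact_eball _ _ x0 1) cG.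
pose d := D y0; have d_ge0 : 0 <= d by rewrite subr_ge0.
have Gpos : 0 < G y0.
  apply: lt_le_trans (y0max _ Ax0).
  by rewrite /G /D subrr enorm0 subr0 !expr1n mulr1.
have d0 : 0 < d.
  rewrite lt_neqAle d_ge0 andbT; apply/eqP => dE.
  by move: Gpos; rewrite /G -/d -dE expr0n /= expr0n eqn0Ngt j0 mulr0 ltxx.
have d1 : d <= 1 by rewrite /d /D gerBl enorm_ge0.
have vy0 := v0 y0.
have d2j0 : 0 < (d ^+ 2) ^+ j by rewrite !exprn_gt0.
pose V := 4 ^+ j * v y0.
have vV z : enorm (z - y0) <= d / 2 -> enorm (z - x0) <= 1 /\ v z <= V.
  move=> zB; have Dz : d / 2 <= D z.
    have : enorm (z - x0) <= enorm (z - y0) + enorm (y0 - x0).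
      by rewrite -[z - x0](subrKA y0) enormD.
    by rewrite /d /D in zB *; clear - zB; lra.
  have Az : A z.
    by rewrite /A /= -subr_ge0; apply: le_trans Dz; rewrite divr_ge0.
  split=> //; have := y0max _ Az; rewrite /G -/d => h.
  have h2 : v z * ((d / 2) ^+ 2) ^+ j <= v y0 * (d ^+ 2) ^+ j.
    apply: le_trans h; rewrite ler_wpM2l ?(ltW (v0 z)) //.
    rewrite lerXn2r ?nnegrE ?sqr_ge0 // lerXn2r ?nnegrE //.
      by rewrite divr_ge0.
    by apply: le_trans Dz; rewrite divr_ge0.
  rewrite -(ler_pM2r d2j0) /V.
  have -> : v z * (d ^+ 2) ^+ j = 4 ^+ j * (v z * ((d / 2) ^+ 2) ^+ j).
    rewrite mulrCA -exprMn; congr (_ * _ ^+ _); by field.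
  by rewrite -mulrA ler_wpM2l ?(ltW k0).
have y0x0 : enorm (y0 - x0) <= 1 by [].
have hsmall z : enorm (z - y0) <= eps * d -> v y0 / 2 <= v z.
  move=> zB.
  have hball w : enorm (w - y0) <= d / 2 -> [/\ 0 <= v w <= V, enorm (beta w) <= K &
      `|\tr (tau w *m (tau w)^T *m Hv w) + dot (beta w) (gv w)| <= c * V].
    move=> wB; have [w1 wV] := vV w wB.
    have w3 : enorm (w - x0) <= 3 by apply: le_trans w1 _; rewrite ler1n.
    have [h1 h2] := hB w w3; split=> //; first by rewrite wV (ltW (v0 w)).
    by apply: le_trans h2 _; rewrite ler_wpM2l.
  have dd : 0 < d / 2 <= 1 by clear - d0 d1; lra.
  have zs : enorm (z - y0) <= s * (d / 2).
    apply: le_trans zB _; have -> : s * (d / 2) = s / 2 * d by ring.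
    by rewrite ler_wpM2r //; clear - eps_s eps0; lra.
  have := hint tau beta v gv Hv y0 (d / 2) V diff dd cv jv hball z zs.
  have sd0 : 0 < s * (d / 2) by rewrite mulr_gt0 // divr_gt0.
  have h : 2 * V / (s * (d / 2)) * enorm (y0 - z) <= 2 * V / (s * (d / 2)) * (eps * d).
    rewrite enormC ler_wpM2l // divr_ge0 ?(ltW sd0) // mulr_ge0 //.
    by rewrite mulr_ge0 ?(ltW k0) ?(ltW vy0).
  have hE : 2 * V / (s * (d / 2)) * (eps * d) = v y0 / 2.
    rewrite /V -epsk; field.
    by rewrite !gt_eqF.
  by rewrite hE in h; clear - h; lra.
pose mu := v y0 / 2; have mu0 : 0 < mu by rewrite divr_gt0.
pose r0 := eps * d; have r00 : 0 < r0 by rewrite mulr_gt0.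
have r01 : r0 <= 1.
  rewrite /r0 -[leRHS]mulr1; apply: ler_pM => //; first exact: ltW.
  by clear - eps_s s2 eps0; lra.
have r0j : (r0 ^+ 2) ^+ j = e2j * (d ^+ 2) ^+ j by rewrite /r0 /e2j -exprMn -exprMn.
have r0j0 : 0 < (r0 ^+ 2) ^+ j by rewrite !exprn_gt0.
have lower : 3 / 4 * (mu * (r0 ^+ 2) ^+ j) <= v x0.
  have [near|far] := leP (enorm (x0 - y0)) r0.
    apply: le_trans (hsmall _ near).
    have : mu * (r0 ^+ 2) ^+ j <= mu * 1.
      rewrite ler_wpM2l ?(ltW mu0) //.
      by rewrite exprn_ile1 // ?sqr_ge0 // exprn_ile1 // ltW.
    by rewrite -/mu; clear - mu0; lra.
  have x02 : r0 <= enorm (x0 - y0) <= 2.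
    by rewrite (ltW far) /= enormC (le_trans y0x0) // ler1n.
  have [ell _ bnd] := diff.
  have hB2 z : enorm (z - y0) <= 2 -> enorm (beta z) <= K /\
       \tr (tau z *m (tau z)^T *m Hv z) + dot (beta z) (gv z) <= c * v z.
    move=> z2; have z3 : enorm (z - x0) <= 3.
      rewrite -[z - x0](subrKA y0); apply: le_trans (enormD _ _) _.
      by clear - z2 y0x0; lra.
    by have [h1 h2] := hB z z3; split=> //; apply: le_trans h2; exact: ler_norm.
  have r02 : r0 <= 2 by clear - r01; lra.
  have := hbar tau beta v gv Hv y0 r0 mu ell bnd r00 r02 mu0 cv jv v0 hB2 hsmall x0 x02.
  apply: le_trans; rewrite mulrC; apply: ler_wpM2l; first exact: ltW (mulr_gt0 mu0 r0j0).
  have S0 : 0 < dot (x0 - y0) (x0 - y0).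
    by rewrite -enorm_sqr exprn_gt0 // (lt_trans r00).
  have S1 : dot (x0 - y0) (x0 - y0) <= 1.
    by rewrite -enorm_sqr exprn_ile1 ?enorm_ge0 // enormC.
  have h1 : 1 <= (dot (x0 - y0) (x0 - y0))^-1 ^+ j.
    by rewrite exprn_ege1 // invf_ge1.
  have h2 : (4^-1 : R) ^+ j <= 4^-1.
    case: {+}j j0 => // i _; rewrite exprS -[leRHS]mulr1 ler_wpM2l //.
    by rewrite exprn_ile1 //; lra.
  by clear - h1 h2; lra.
have Ay : A y by apply: le_trans yB _; lra.
have Dy : 1 / 2 <= D y by rewrite /D; clear - yB; lra.
have := y0max _ Ay; rewrite /G -/d => hy.
have hy2 : v y * 4^-1 ^+ j <= v y0 * (d ^+ 2) ^+ j.
  apply: le_trans hy; rewrite ler_wpM2l ?(ltW (v0 y)) //.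
  have -> : 4^-1 = (1 / 2) ^+ 2 :> R by field.
  rewrite lerXn2r ?nnegrE ?sqr_ge0 // lerXn2r ?nnegrE //.
  by apply: le_trans Dy.
rewrite mulrC ler_pdivlMr //.
apply: le_trans lower; rewrite r0j /C0 /mu.
have := ler_wpM2r (ltW (mulr_gt0 (_ : 0 < 3 / 8 :> R) e2j0)) hy2.
rewrite (_ : (0 < 3 / 8 :> R)) // => /(_ isT).
by clear; lra.
Qed.

(** Harnack turns the upper bound that the interior estimate uses into a multiple
    of the value at the centre, so the gradient is compared with this value. *)
Lemma log_gradient_bound m (th L T K c : R) :
  0 < th -> 0 < L -> 0 <= T -> 0 <= K -> 0 <= c ->
  exists2 C : R, 0 < C &
    forall tau (beta : 'cV[R]_m -> 'cV[R]_m) (v : 'cV[R]_m -> R) gv Hv x0,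
    diffusion_bounds tau th L T ->
    continuous v -> (forall y, jet2 v y (gv y) (Hv y)) -> (forall y, 0 < v y) ->
    (forall y, enorm (y - x0) <= 3 -> enorm (beta y) <= K /\
       `|\tr (tau y *m (tau y)^T *m Hv y) + dot (beta y) (gv y)| <= c * v y) ->
    enorm (gv x0) <= C * v x0.
Proof.
move=> th0 L0 T0 K0 c0.
have [s /andP[s0 s2] hint] := interior_lipschitz m th0 L0 T0 K0 c0.
have [C C0 hC] := harnack m th0 L0 T0 K0 c0.
exists (4 * C / s); first by rewrite divr_gt0 // mulr_gt0.
move=> tau beta v gv Hv x0 diff cv jv v0 hB.
have hV := hC tau beta v gv Hv x0 diff cv jv v0 hB.
pose V := C * v x0.
have hball w : enorm (w - x0) <= 1 / 2 -> [/\ 0 <= v w <= V, enorm (beta w) <= K &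
    `|\tr (tau w *m (tau w)^T *m Hv w) + dot (beta w) (gv w)| <= c * V].
  move=> wB; have wV := hV w wB.
  have w3 : enorm (w - x0) <= 3 by apply: le_trans wB _; lra.
  have [h1 h2] := hB w w3; split=> //; first by rewrite wV (ltW (v0 w)).
  by apply: le_trans h2 _; rewrite ler_wpM2l.
have half : 0 < 1 / 2 :> R by lra.
have half1 : 0 < (1 / 2 : R) <= 1 by rewrite half ler_pdivrMr // mul1r ler1n.
have lip := hint tau beta v gv Hv x0 (1 / 2) V diff half1 cv jv hball.
have [->|g0] := eqVneq (gv x0) 0.
  rewrite enorm0; apply: mulr_ge0; last exact: ltW.
  by rewrite divr_ge0 ?mulr_ge0 // ltW.
rewrite -enorm_gt0 in g0.
have sg0 : 0 < s * (1 / 2) / enorm (gv x0) by rewrite divr_gt0 // mulr_gt0.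
suff : - dot (gv x0) (- gv x0) <= 4 * C / s * v x0 * enorm (gv x0).
  by rewrite dotNr opprK -enorm_sqr expr2 ler_pM2r.
apply: (expands2_slope (jv x0 (- gv x0)) sg0) => t /andP[t0 ts].
rewrite ltr_pdivlMr // in ts.
have nt : enorm (x0 + t *: - gv x0 - x0) = t * enorm (gv x0).
  by rewrite addrAC subrr add0r enormZ enormN gtr0_norm.
have := lip (x0 + t *: - gv x0); rewrite nt => /(_ (ltW ts)).
rewrite enormC nt => h; apply: le_trans h _.
rewrite le_eqVlt; apply/orP; left; apply/eqP.
by rewrite /V; field; rewrite gt_eqF.
Qed.

End Harnack.

(** * The equation with quadratic gradient term *)

Section Critical.
Context {R : realType}.

Lemma penalized_max k (w : 'cV[R]_k -> R) gw Hw W (eps : R) x :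
  continuous w -> (forall y, jet2 w y (gw y) (Hw y)) -> (forall y, `|w y| <= W) ->
  0 < eps ->
  exists y, [/\ w x - eps * dot x x <= w y - eps * dot y y, gw y = (2 * eps) *: y &
    forall l (A : 'M[R]_(k, l)), \tr (A *m A^T *m Hw y) <= 2 * eps * fro2 A].
Proof.
move=> cw jw bw eps0.
pose G y := w y - eps * dot (y - 0) (y - 0).
have cG : continuous G.
  apply: continuous_subr => //; apply: continuous_scaler; exact: dot_sub_continuous.
have W0 : 0 <= W := le_trans (normr_ge0 _) (bw 0).
pose rho := Num.sqrt (2 * W / eps).
have rho2 : eps * rho ^+ 2 = 2 * W.
  by rewrite sqr_sqrtr ?divr_ge0 ?mulr_ge0 ?(ltW eps0) // mulrC divfK // gt_eqF.
pose K := [set y : 'cV[R]_k | enorm (y - 0) <= rho].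
have K0 : K 0 by rewrite /K /= subr0 enorm0 sqrtr_ge0.
have [y _ ymax] := compact_max K0 (@compact_eball _ _ 0 rho) cG.
have {}ymax z : G z <= G y.
  have [zK|zK] := leP (enorm (z - 0)) rho; first exact: ymax.
  apply: le_trans (ymax 0 K0); rewrite /G !subr0 dot0l mulr0 subr0.
  have := bw z; have := bw 0; rewrite !ler_norml => /andP[a1 a2] /andP[a3 a4].
  have : eps * rho ^+ 2 <= eps * dot z z.
    rewrite ler_wpM2l ?(ltW eps0) // -enorm_sqr ler_pXn2r ?nnegrE ?sqrtr_ge0 ?enorm_ge0 //.
    by rewrite subr0 in zK; exact: ltW.
  by clear - rho2 a1 a4; lra.
have jG := jet2B (jw y) (jet2Z eps (jet2_sqr 0 y)).
have [|q0 tr] := line_max jG; first by move=> xi; exists 1 => // t _; exact: ymax.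
exists y; split.
- by have := ymax x; rewrite /G !subr0.
- by move/eqP: q0; rewrite subr_eq0 subr0 scalerA (mulrC eps) => /eqP.
- by move=> l A; have := tr l A; rewrite mxtrace_sub_scalar; clear; lra.
Qed.

Definition critical_equation m (tau : 'cV[R]_m -> 'M[R]_m) (b s : 'cV[R]_m -> 'cV[R]_m)
    (delta : R) (w : 'cV[R]_m -> R) gw Hw :=
  forall y, delta * w y = \tr (tau y *m (tau y)^T *m Hw y)
    + enorm ((tau y)^T *m gw y + s y) ^+ 2 + dot (b y) (gw y).

Lemma enormD_sqr_le k (u v : 'cV[R]_k) :
  enorm (u + v) ^+ 2 <= 2 * enorm u ^+ 2 + 2 * enorm v ^+ 2.
Proof.
have := dot_ge0 (u - v); rewrite !enorm_sqr !dotDE (dotC v u); clear; lra.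
Qed.

(** At a penalized extremum [y] the gradient is [2 * eps * y] up to sign: the drift
    pushes inwards with strength [eps * |y|^2], while the quadratic term is only of
    order [eps^2 * |y|^2]. *)
Lemma critical_equation_sup m (tau : 'cV[R]_m -> 'M[R]_m) b s delta w gw Hw W (T K S : R) binf :
  (forall y, fro2 (tau y) <= T) -> reverting b binf K -> (forall y, enorm (s y) <= S) ->
  0 < delta -> continuous w -> (forall y, jet2 w y (gw y) (Hw y)) ->
  (forall y, `|w y| <= W) -> critical_equation tau b s delta w gw Hw ->
  forall x, `|delta * w x| <= 2 * S ^+ 2 + 1.
Proof.
move=> bnd hb hs delta0 cw jw bw eqw x.
have T0 : 0 <= T := le_trans (fro2_ge0 _) (bnd 0).
have S0 : 0 <= S := le_trans (enorm_ge0 _) (hs 0).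
pose D := (K + enorm binf) ^+ 2; have D0 : 0 <= D := sqr_ge0 _.
pose X := delta * dot x x; have X0 : 0 <= X by rewrite mulr_ge0 ?dot_ge0 // ltW.
have Q0 : 0 < 2 * T + 2 * D + X + 1 by clear - T0 D0 X0; lra.
have T1 : 0 < 8 * T + 1 by clear - T0; lra.
pose eps : R := Num.min (8 * T + 1)^-1 (2 * T + 2 * D + X + 1)^-1.
have eps0 : 0 < eps by rewrite lt_min !invr_gt0 T1.
have epsT : eps * (8 * T) <= 1.
  have : eps * (8 * T + 1) <= 1 by rewrite -ler_pdivlMr // mul1r ge_min lexx.
  by clear - eps0; lra.
have epsQ : eps * (2 * T + 2 * D + X) <= 1.
  have : eps * (2 * T + 2 * D + X + 1) <= 1.
    by rewrite -ler_pdivlMr // mul1r ge_min lexx orbT.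
  by clear - eps0; lra.
have revy y : dot (b y) y <= D - dot y y / 2 := reverting_dot y hb.
have epsM (u v : R) : u <= v -> eps * u <= eps * v by move=> uv; rewrite ler_wpM2l // ltW.
have delM (u v : R) : u <= v -> delta * u <= delta * v by move=> uv; rewrite ler_wpM2l // ltW.
rewrite ler_norml; apply/andP; split.
- have jN y : jet2 (fun y => -1 * w y) y (-1 *: gw y) (-1 *: Hw y) by exact: jet2Z.
  have cN : continuous (fun y => -1 * w y) by exact: continuous_scaler.
  have bN y : `|-1 * w y| <= W by rewrite mulN1r normrN.
  have [y [h1 h2 h3]] := penalized_max x cN jN bN eps0.
  have gy : gw y = - (2 * eps) *: y.
    by rewrite scaleNr -h2 scaleN1r opprK.
  have := eqw y; rewrite gy dotZr.
  have := sqr_ge0 (enorm ((tau y)^T *m (- (2 * eps) *: y) + s y)).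
  have := h3 m (tau y); rewrite -scalemxAr linearZ /= mulN1r.
  have := epsM _ _ (revy y); have := epsM _ _ (bnd y).
  have := epsM _ _ (dot_ge0 y).
  have := delM _ _ h1; have := sqr_ge0 S.
  have : 0 <= delta * (eps * dot y y) by rewrite !mulr_ge0 ?dot_ge0 // ltW.
  have XE : delta * (eps * dot x x) = eps * X by rewrite /X; ring.
  by clear - epsQ XE; lra.
- have [y [h1 h2 h3]] := penalized_max x cw jw bw eps0.
  have := eqw y; rewrite h2 dotZr.
  have hn := enormD_sqr_le ((tau y)^T *m ((2 * eps) *: y)) (s y).
  have h5 : enorm ((tau y)^T *m ((2 * eps) *: y)) ^+ 2 <= eps / 2 * dot y y.
    apply: le_trans (enorm_mul_sqr_le _ _) _.
    rewrite fro2_tr enorm_sqr dotZl dotZr.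
    have -> : fro2 (tau y) * (2 * eps * (2 * eps * dot y y)) =
        eps / 2 * dot y y * (eps * (8 * fro2 (tau y))) by field.
    have n0 : 0 <= eps / 2 * dot y y by rewrite mulr_ge0 ?dot_ge0 // divr_ge0 // ltW.
    rewrite -[leRHS]mulr1; apply: ler_wpM2l => //; apply: le_trans epsT.
    by apply: epsM; rewrite ler_wpM2l.
  have h6 : enorm (s y) ^+ 2 <= S ^+ 2 by rewrite ler_pXn2r ?nnegrE ?enorm_ge0.
  have := h3 m (tau y).
  have := epsM _ _ (revy y); have := epsM _ _ (bnd y).
  have := delM _ _ h1.
  have : 0 <= delta * (eps * dot y y) by rewrite !mulr_ge0 ?dot_ge0 // ltW.
  have XE : delta * (eps * dot x x) = eps * X by rewrite /X; ring.
  by clear - epsQ XE hn h5 h6; lra.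
Qed.

(** The exponential turns the quadratic equation into a linear one with a bounded
    zero-order coefficient [delta w - |s|^2], for which the Harnack inequality
    bounds the logarithmic gradient, that is, the gradient of [w]. *)
Lemma critical_equation_local m (th L T K S rad : R) (binf : 'cV[R]_m) :
  0 < th -> 0 < L -> 0 <= T -> 0 <= K -> 0 <= S -> 0 <= rad ->
  exists2 C : R, 0 < C &
    forall (tau : 'cV[R]_m -> 'M[R]_m) b s delta w gw Hw W,
    diffusion_bounds tau th L T -> reverting b binf K -> (forall y, enorm (s y) <= S) ->
    0 < delta -> continuous w -> (forall y, jet2 w y (gw y) (Hw y)) ->
    (forall y, `|w y| <= W) -> critical_equation tau b s delta w gw Hw ->
    forall x, enorm x <= rad -> enorm (gw x) <= C.
Proof.
move=> th0 L0 T0 K0 S0 rad0.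
pose K' : R := K + enorm binf + rad + 3 + 2 * (Num.sqrt T * S).
have b0 := enorm_ge0 binf.
have TS0 : 0 <= Num.sqrt T * S by rewrite mulr_ge0 ?sqrtr_ge0.
have K'0 : 0 <= K' by rewrite /K'; clear - K0 b0 rad0 TS0; lra.
have c0 : 0 <= 3 * S ^+ 2 + 1 by have := sqr_ge0 S; clear; lra.
have [C C0 hC] := log_gradient_bound m th0 L0 T0 K'0 c0.
exists C => // tau b s delta w gw Hw W diff hb hs delta0 cw jw bw eqw x xrad.
have [ell lip bnd] := diff.
pose v y := expR (w y).
pose beta y := b y + 2 *: (tau y *m s y).
have cv : continuous v.
  move=> y; apply: (@continuous_comp _ _ _ w expR); first exact: cw.
  exact: continuous_expR.
have jv y : jet2 v y (expR (w y) *: gw y)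
    (expR (w y) *: Hw y + (2 * (expR (w y) / 2)) *: (gw y *m (gw y)^T)).
  exact: jet2_comp (jw y) (expands2_expR _).
have v0 y : 0 < v y := expR_gt0 _.
suff : enorm (expR (w x) *: gw x) <= C * v x.
  by rewrite enormZ (gtr0_norm (expR_gt0 _)) mulrC ler_pM2r ?expR_gt0.
apply: (hC tau beta v _ _ x diff cv jv v0) => y yx; split.
  rewrite /beta; apply: le_trans (enormD _ _) _.
  have h1 : enorm (b y) <= K + (enorm binf + enorm y).
    rewrite -[b y](subrK (binf - y)); apply: le_trans (enormD _ _) _.
    by rewrite lerD // enormB.
  have h2 : enorm y <= rad + 3.
    rewrite -[y](subrK x); apply: le_trans (enormD _ _) _.
    by clear - yx xrad; lra.
  have h3 : enorm (2 *: (tau y *m s y)) <= 2 * (Num.sqrt T * S).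
    rewrite enormZ ger0_norm // ler_wpM2l //; apply: le_trans (enorm_mul_le _ _) _.
    by rewrite ler_pM ?sqrtr_ge0 ?enorm_ge0 // ler_sqrt.
  by rewrite /K'; clear - h1 h2 h3; lra.
have -> : \tr (tau y *m (tau y)^T *m
      (expR (w y) *: Hw y + (2 * (expR (w y) / 2)) *: (gw y *m (gw y)^T))) +
    dot (beta y) (expR (w y) *: gw y) =
    v y * (delta * w y - enorm (s y) ^+ 2).
  rewrite eqw (_ : 2 * (expR (w y) / 2) = v y); last by rewrite /v; field.
  have h1 : \tr (tau y *m (tau y)^T *m (gw y *m (gw y)^T)) =
      enorm ((tau y)^T *m gw y) ^+ 2.
    by rewrite mulmxA mxtrace_outer -mulmxA dot_mull enorm_sqr.
  have h2 : enorm ((tau y)^T *m gw y + s y) ^+ 2 = enorm ((tau y)^T *m gw y) ^+ 2 +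
      2 * dot (tau y *m s y) (gw y) + enorm (s y) ^+ 2.
    rewrite [enorm (_ + _) ^+ 2]enorm_sqr !dotDl !dotDr -!enorm_sqr.
    by rewrite (dotC _ (s y)) (dot_mull (tau y)); ring.
  have h3 : \tr (tau y *m (tau y)^T *m (v y *: Hw y + v y *: (gw y *m (gw y)^T))) =
      v y * (\tr (tau y *m (tau y)^T *m Hw y) + enorm ((tau y)^T *m gw y) ^+ 2).
    by rewrite -scalerDr -scalemxAr mulmxDr !linearZ /= linearD /= h1.
  by rewrite -/(v y) h3 h2 /beta dotDl !(dotZr (v y)) (dotZl 2); ring.
have h7 := critical_equation_sup bnd hb hs delta0 cw jw bw eqw y.
have h6 : enorm (s y) ^+ 2 <= S ^+ 2 by rewrite ler_pXn2r ?nnegrE ?enorm_ge0.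
rewrite normrM gtr0_norm // mulrC; apply: ler_wpM2r; first exact: ltW.
apply: le_trans (ler_normB _ _) _; rewrite (ger0_norm (sqr_ge0 _)).
by clear - h6 h7; lra.
Qed.

(** At a maximum of the doubled function with a linear profile of slope [C] both
    gradients have norm about [C]; the local bound then expels both points to the
    region where the diffusion is constant and the drift contracts distances at
    unit rate.  There the quadratic terms differ by about
    [eta * |y - z| * (2 * M * C + 2 * S)], which for small [eta] cannot compensate
    the contraction [C * |y - z|]. *)
Lemma critical_equation_lipschitz m (th L T K S : R) (binf : 'cV[R]_m) :
  0 < th -> 0 < L -> 0 <= T -> 0 <= K -> 0 <= S ->
  exists2 eta : R, 0 < eta & forall rad : R, 0 <= rad -> exists2 C : R, 0 < C &
    forall (tau : 'cV[R]_m -> 'M[R]_m) b s delta w gw Hw W,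
    diffusion_bounds tau th L T -> reverting b binf K -> (forall y, enorm (s y) <= S) ->
    (forall y z, rad < enorm y -> rad < enorm z ->
      [/\ b y - b z = z - y, tau y = tau z & enorm (s y - s z) <= eta * enorm (y - z)]) ->
    0 < delta -> continuous w -> (forall y, jet2 w y (gw y) (Hw y)) ->
    (forall y, `|w y| <= W) -> critical_equation tau b s delta w gw Hw ->
    forall y z, w y - w z <= C * enorm (y - z).
Proof.
move=> th0 L0 T0 K0 S0.
pose M := Num.sqrt T; have M0 : 0 <= M := sqrtr_ge0 _.
have M1 : 0 < 8 * (M + 1) by clear - M0; lra.
pose eta : R := (8 * (M + 1))^-1.
have eta0 : 0 < eta by rewrite invr_gt0.
have etaM : eta * (8 * (M + 1)) = 1 by rewrite mulVf // gt_eqF.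
exists eta => // rad rad0.
have [Cl Cl0 hloc] := critical_equation_local binf th0 L0 T0 K0 S0 rad0.
pose C : R := Cl + S + 3; have C0 : 0 < C by rewrite /C; clear - Cl0 S0; lra.
exists C => // tau b s delta w gw Hw W diff hb hs hfar delta0 cw jw bw eqw y0 z0.
have [ell lip bnd] := diff.
rewrite leNgt; apply/negP => h0.
pose phi (r : R) := C * r.
have cphi : continuous phi by apply: continuous_scaler => x; exact: cvg_id.
have phi0 : phi 0 = 0 by rewrite /phi mulr0.
have phi_ge0 (r : R) : 0 <= r -> 0 <= phi r by move=> r0; rewrite mulr_ge0 // ltW.
have jphi (r : R) : 0 < r -> expands2 (fun s => phi (r + s)) (phi r) C 0.
  by move=> _; apply: expands2_poly => t; rewrite /phi; ring.
have [gap gap0 H] := doubling cw jw bw cphi phi0 phi_ge0 jphi h0.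
pose D := (K + enorm binf) ^+ 2; have D0 : 0 <= D := sqr_ge0 _.
have W0 : 0 <= W := le_trans (normr_ge0 _) (bw 0).
pose N : R := M * (2 * C + 4) + 2 * S.
have N0 : 0 <= N by rewrite addr_ge0 ?mulr_ge0 //; clear - C0; lra.
pose g := delta * gap; have g0 : 0 < g by rewrite mulr_gt0.
have q1 : 0 < 4 * (4 * T + 4 * D + 1) by clear - T0 D0; lra.
have MN0 : 0 <= M * N by rewrite mulr_ge0.
have q2 : 0 < 4 * (4 * (M * N) + 1) by clear - MN0; lra.
have q3 : 0 < 2 * W + 1 by clear - W0; lra.
(* [zt] will bound [eps * |y|] and [eps * |z|], [ep] bounds [eps] itself; both are
   so small that the penalization errors add up to at most [g / 2] *)
pose zt : R := Num.min 1 (g / (4 * (4 * (M * N) + 1))).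
have zt0 : 0 < zt by rewrite lt_min ltr01 divr_gt0.
have zt1 : zt <= 1 by rewrite ge_min lexx.
have ztg : zt * (4 * (4 * (M * N) + 1)) <= g by rewrite -ler_pdivlMr // ge_min lexx orbT.
pose ep : R := Num.min (g / (4 * (4 * T + 4 * D + 1))) (zt ^+ 2 / (2 * W + 1)).
have ep0 : 0 < ep by rewrite lt_min !divr_gt0 // exprn_gt0.
have [eps [y [z [[eps0 eps_lt yz] hgap gy gz htr]]]] := H _ ep0.
set r := enorm (y - z) in gy gz htr; set e := r^-1 *: (y - z) in gy gz htr.
have epsg : eps * (4 * (4 * T + 4 * D + 1)) <= g.
  rewrite -ler_pdivlMr //; apply: le_trans (ltW eps_lt) _.
  by rewrite ge_min lexx.
have epsW : eps * (2 * W + 1) <= zt ^+ 2.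
  rewrite -ler_pdivlMr //; apply: le_trans (ltW eps_lt) _.
  by rewrite ge_min lexx orbT.
have r0 : 0 < r by rewrite enorm_gt0 subr_eq0.
have e1 : enorm e = 1 by rewrite enorm_unit // subr_eq0.
have dyz : w y - w z <= 2 * W.
  have := bw y; have := bw z; rewrite !ler_norml => /andP[a1 _] /andP[_ a2].
  by clear - a1 a2; lra.
have small u : eps * dot u u <= 2 * W -> eps * enorm u <= zt.
  move=> hu; rewrite -(ler_pXn2r (n := 2)) ?nnegrE ?mulr_ge0 ?enorm_ge0 ?(ltW eps0) ?(ltW zt0) //.
  apply: le_trans epsW; rewrite exprMn enorm_sqr expr2 -mulrA.
  by apply: ler_wpM2l; [exact: ltW|clear - hu; lra].
have ey : eps * enorm y <= zt.
  apply: small; have := mulr_ge0 (ltW eps0) (dot_ge0 z).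
  by clear - hgap dyz gap0; lra.
have ez : eps * enorm z <= zt.
  apply: small; have := mulr_ge0 (ltW eps0) (dot_ge0 y).
  by clear - hgap dyz gap0; lra.
have nCe : enorm (C *: e) = C by rewrite enormZ e1 mulr1 gtr0_norm.
have n2 u : enorm ((2 * eps) *: u) = 2 * (eps * enorm u).
  by rewrite enormZ ger0_norm ?mulrA // mulr_ge0 // ltW.
have yfar : rad < enorm y.
  rewrite ltNge; apply/negP => yrad.
  have := hloc tau b s delta w gw Hw W diff hb hs delta0 cw jw bw eqw y yrad.
  have := enorm_sub_le (C *: e) (- ((2 * eps) *: y)).
  rewrite opprK -gy nCe enormN n2 /C.
  by clear - ey zt1 S0; lra.
have zfar : rad < enorm z.
  rewrite ltNge; apply/negP => zrad.
  have := hloc tau b s delta w gw Hw W diff hb hs delta0 cw jw bw eqw z zrad.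
  have := enorm_sub_le (C *: e) ((2 * eps) *: z).
  rewrite -gz nCe n2 /C.
  by clear - ez zt1 S0; lra.
have [bE tE sE] := hfar y z yfar zfar.
have eqy := eqw y; have eqz := eqw z.
have tr_le : \tr (tau y *m (tau y)^T *m Hw y) - \tr (tau z *m (tau z)^T *m Hw z) <=
    4 * (eps * T).
  have := htr m (tau y) (tau z).
  rewrite tE subrr trmx0 mul0mx enorm0 /fro2 mul0mx linear0 -/(fro2 (tau z)).
  have : eps * fro2 (tau z) <= eps * T by rewrite ler_wpM2l // ltW.
  by rewrite expr0n /= subrr !mulr0; clear; lra.
have b_le : dot (b y) (gw y) - dot (b z) (gw z) <= - (C * r) + 4 * (eps * D).
  have -> : dot (b y) (gw y) - dot (b z) (gw z) =
      C * dot (b y - b z) e + 2 * (eps * (dot (b y) y + dot (b z) z)).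
    by rewrite gy gz dotBl dotDr dotBr !(dotZr C) !(dotZr (2 * eps)); ring.
  have -> : dot (b y - b z) e = - r.
    have yzE : y - z = r *: e by rewrite /e enormZ_unit.
    by rewrite bE -opprB yzE dotNl dotZl -enorm_sqr e1 expr1n mulr1.
  have : eps * (dot (b y) y + dot (b z) z) <= eps * (2 * D).
    apply: ler_wpM2l; first exact: ltW.
    have := reverting_dot y hb; have := reverting_dot z hb.
    by have := dot_ge0 y; have := dot_ge0 z; rewrite -/D; clear; lra.
  by clear; lra.
set X := (tau y)^T *m gw y + s y in eqy; set Y := (tau z)^T *m gw z + s z in eqz.
have tauM u : enorm ((tau z)^T *m u) <= M * enorm u.
  apply: le_trans (enorm_mul_le _ _) _; rewrite ler_wpM2r ?enorm_ge0 //.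
  by rewrite fro2_tr ler_sqrt.
have XY1 : enorm (X - Y) <= 4 * (M * zt) + eta * r.
  have -> : X - Y = (tau z)^T *m ((2 * eps) *: y + (2 * eps) *: z) + (s y - s z).
    rewrite /X /Y tE gy gz !mulmxDr mulmxN.
    by apply/matrixP => i j; rewrite !mxE; ring.
  apply: le_trans (enormD _ _) _; apply: lerD => //.
  apply: le_trans (tauM _) _.
  have : M * enorm ((2 * eps) *: y + (2 * eps) *: z) <= M * (4 * zt).
    apply: ler_wpM2l => //; apply: le_trans (enormD _ _) _; rewrite !n2.
    by clear - ey ez; lra.
  by clear; lra.
have XY2 : enorm (X + Y) <= N.
  have -> : X + Y = (tau z)^T *m (2 *: (C *: e) + ((2 * eps) *: y - (2 * eps) *: z))
                    + (s y + s z).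
    rewrite /X /Y tE gy gz !mulmxDr mulmxN scaler_nat mulmxDr.
    by apply/matrixP => i j; rewrite !mxE; ring.
  apply: le_trans (enormD _ _) _; rewrite /N; apply: lerD.
    apply: le_trans (tauM _) _; apply: ler_wpM2l => //.
    apply: le_trans (enormD _ _) _; rewrite enormZ nCe ger0_norm //.
    have := enormB ((2 * eps) *: y) ((2 * eps) *: z); rewrite !n2.
    by clear - ey ez zt1; lra.
  apply: le_trans (enormD _ _) _; have := hs y; have := hs z.
  by clear; lra.
have XYE : enorm X ^+ 2 - enorm Y ^+ 2 = dot (X - Y) (X + Y).
  by clearbody X Y; rewrite !enorm_sqr dotBl !dotDr (dotC Y X); ring.
have sq_le : enorm X ^+ 2 - enorm Y ^+ 2 <= (4 * (M * zt) + eta * r) * N.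
  rewrite XYE; apply: le_trans (dot_le _ _) _.
  by rewrite ler_pM ?enorm_ge0.
have etaN : eta * N <= C.
  have eM : eta * (M * (2 * C + 4)) <= (2 * C + 4) / 8.
    have -> : (2 * C + 4) / 8 = eta * ((M + 1) * (2 * C + 4)).
      rewrite [RHS](_ : _ = eta * (8 * (M + 1)) * ((2 * C + 4) / 8)); last by field.
      by rewrite etaM mul1r.
    apply: ler_wpM2l; first exact: ltW.
    by clear - C0; lra.
  have eS : eta * S <= S / 8.
    have -> : S / 8 = eta * ((M + 1) * S).
      rewrite [RHS](_ : _ = eta * (8 * (M + 1)) * (S / 8)); last by field.
      by rewrite etaM mul1r.
    apply: ler_wpM2l; first exact: ltW.
    have := mulr_ge0 M0 S0; clear; lra.
  have : S + 3 <= C by rewrite /C; clear - Cl0; lra.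
  by rewrite /N; clear - eM eS S0; lra.
have etaNr : eta * N * r <= C * r by rewrite ler_wpM2r // ltW.
have hdel : g <= delta * (w y - w z).
  rewrite /g; apply: ler_wpM2l; first exact: ltW.
  have : 0 <= eps * (dot y y + dot z z) by rewrite mulr_ge0 ?addr_ge0 ?dot_ge0 // ltW.
  by clear - hgap; lra.
by clear - eqy eqz tr_le b_le sq_le etaNr hdel ztg epsg g0 zt0 eps0; lra.
Qed.

End Critical.

(** * Reduction of the hypotheses *)

Section Reduction.
Context {R : realType}.

Lemma enorm_delta k (i : 'I_k) : enorm (delta_mx i 0 : 'cV[R]_k) = 1.
Proof.
rewrite /enorm (_ : dot _ _ = 1) ?sqrtr1 // /dot (bigD1 i) //= big1 ?addr0.
  by rewrite !mxE !eqxx mulr1.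
by move=> j ji; rewrite !mxE (negbTE ji) mulr0.
Qed.

(** The drift is known exactly at one point outside the ball, and the Lipschitz
    bound propagates this information inwards; a point outside a ball exists in
    positive dimension only. *)
Lemma condU_reverting m (binf : 'cV[R]_m) (R1 Lb : R) : (0 < m)%N ->
  exists2 K : R, 0 <= K & forall b tau tauinf,
    b_std b Lb -> condU b tau binf tauinf R1 -> reverting b binf K.
Proof.
move=> m0; pose p : 'cV[R]_m := (`|R1| + 1) *: delta_mx (Ordinal m0) 0.
have r0 : 0 < `|R1| + 1 by rewrite ltr_wpDl.
have L0 : 0 <= `|Lb| + 1 by rewrite addr_ge0.
have pE : enorm p = `|R1| + 1 by rewrite enormZ enorm_delta mulr1 gtr0_norm.
have R1p : R1 < enorm p by rewrite pE; have := ler_norm R1; lra.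
have K0 : 0 <= (`|Lb| + 1) * (2 * (`|R1| + 1)) by rewrite mulr_ge0 // mulr_ge0 // ltW.
exists ((`|Lb| + 1) * (2 * (`|R1| + 1))) => // b tau tauinf hb hU y.
have [yR|yR] := ltP R1 (enorm y).
  by have [-> _] := hU y yR; rewrite subrr enorm0.
have [bp _] := hU p R1p.
have -> : b y - (binf - y) = (b y - b p) + (y - p).
  by rewrite bp; apply/matrixP => i j; rewrite !mxE; ring.
have yp : enorm (y - p) <= 2 * (`|R1| + 1).
  apply: le_trans (enormB _ _) _; rewrite pE; have := ler_norm R1.
  by clear - yR; lra.
apply: le_trans (enormD _ _) _.
have h1 : enorm (b y - b p) <= `|Lb| * enorm (y - p).
  by apply: le_trans (hb y p) _; rewrite ler_wpM2r ?enorm_ge0 ?ler_norm.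
have h2 : (`|Lb| + 1) * enorm (y - p) <= (`|Lb| + 1) * (2 * (`|R1| + 1)).
  by rewrite ler_wpM2l.
by clear - h1 h2; lra.
Qed.

Lemma tau_std_diffusion m (tau : 'cV[R]_m -> 'M[R]_m) Mtau Ltau th :
  tau_std tau Mtau Ltau th ->
  diffusion_bounds tau th (m%:R * `|Ltau| + 1) ((m * m)%:R * Mtau ^+ 2).
Proof.
move=> [hM hL hell]; split=> [y xi|y z|y].
- have [->|xi0] := eqVneq xi 0; first by rewrite enorm0 expr0n mulr0 sqr_ge0.
  exact: ltW (hell y xi xi0).
- apply: le_trans (fro2_le (hL y z)) _.
  rewrite natrM -expr2 -exprMn -[leLHS]real_normK ?num_real //.
  rewrite lerXn2r ?nnegrE // ?mulr_ge0 ?addr_ge0 ?mulr_ge0 ?enorm_ge0 //.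
  rewrite !normrM (ger0_norm (enorm_ge0 _)) normr_nat mulrA.
  by rewrite ler_wpM2r ?enorm_ge0 // lerDl.
- exact: fro2_le.
Qed.

Lemma enorm_trmx_mul_le n m (A : 'M[R]_(n, m)) p M : `|A| <= M ->
  enorm (A^T *m p) <= Num.sqrt (n * m)%:R * M * enorm p.
Proof.
move=> AM; have M0 : 0 <= M := le_trans (normr_ge0 _) AM.
apply: le_trans (enorm_mul_le _ _) _; rewrite ler_wpM2r ?enorm_ge0 //.
have -> : Num.sqrt (n * m)%:R * M = Num.sqrt ((n * m)%:R * M ^+ 2).
  by rewrite sqrtrM // sqrtr_sqr ger0_norm.
rewrite ler_sqrt ?fro2_tr ?fro2_le //.
by rewrite mulr_ge0 ?sqr_ge0.
Qed.

Lemma cell_eq_critical_equation n m (sigma : 'cV[R]_n -> 'cV[R]_m -> 'M[R]_(n, m))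
    b tau x p delta w : cell_eq_critical sigma b tau x p delta w ->
  critical_equation tau b (fun y => (sigma x y)^T *m p) delta w (grad w) (hess w).
Proof.
move=> h y; have := h y; set s := (sigma x y)^T *m p.
have -> : dot (tau y *m (sigma x y)^T *m p) (grad w y) =
    dot ((tau y)^T *m grad w y) s.
  by rewrite -mulmxA -/s dot_mull dotC.
have -> : enorm ((tau y)^T *m grad w y + s) ^+ 2 =
    enorm ((tau y)^T *m grad w y) ^+ 2 + 2 * dot ((tau y)^T *m grad w y) s
    + enorm s ^+ 2.
  by rewrite !enorm_sqr !dotDl !dotDr (dotC s); ring.
by clear; lra.
Qed.

Lemma bounded_fun_exists m (w : 'cV[R]_m -> R) :
  bounded_fun w -> exists W, forall y, `|w y| <= W.
Proof.
move=> [M [_ hM]]; exists (M + 1) => y; apply: hM => //.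
by rewrite ltrDl.
Qed.

End Reduction.

Theorem proposition5p1 (R : realType) (n m : nat) (xbar pbar : 'cV[R]_n)
    (Mtau Msigma Ltau Lb Lsigma : R)
    (theta R1 : R) (binf : 'cV[R]_m) (rad : 'cV[R]_n -> R -> R)
    (theta_gt0 : 0 < theta) :
  exists2 C : R, 0 < C &
    forall (alpha : R)
      (sigma : 'cV[R]_n -> 'cV[R]_m -> 'M[R]_(n, m))
      (b : 'cV[R]_m -> 'cV[R]_m) (tau : 'cV[R]_m -> 'M[R]_m)
      (tauinf : 'M[R]_m),
      2 <= alpha ->
      sigma_std sigma Msigma Lsigma ->
      b_std b Lb ->
      tau_std tau Mtau Ltau theta ->
      condU b tau binf tauinf R1 ->
      condS alpha sigma rad ->
      forall (delta : R) (w : 'cV[R]_m -> R),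
        0 < delta ->
        C2 w ->
        bounded_fun w ->
        cell_eq alpha sigma b tau xbar pbar delta w ->
        forall y z : 'cV[R]_m, `|w y - w z| <= C * enorm (y - z).
Proof.
have [m0|m0] := posnP m.
  exists 1 => // alpha sigma b tau tauinf _ _ _ _ _ _ delta w _ _ _ _ y z.
  have -> : y = z by apply/matrixP => i; have := ltn_ord i; rewrite {2}m0.
  by rewrite !subrr normr0 enorm0 mulr0.
have [K K0 hK] := condU_reverting binf R1 Lb m0.
pose L : R := m%:R * `|Ltau| + 1; have L0 : 0 < L by rewrite ltr_wpDl ?mulr_ge0.
pose T : R := (m * m)%:R * Mtau ^+ 2.
have T0 : 0 <= T by rewrite mulr_ge0 ?sqr_ge0.
pose q : R := Num.sqrt (n * m)%:R * enorm pbar.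
have q0 : 0 <= q by rewrite mulr_ge0 ?sqrtr_ge0 ?enorm_ge0.
pose S : R := q * `|Msigma|; have S0 : 0 <= S by rewrite mulr_ge0.
have [C1 C10 hlin] := linear_equation_lipschitz K binf theta_gt0 L0 T0 (sqr_ge0 S).
have [eta eta0 hcrit] := critical_equation_lipschitz binf theta_gt0 L0 T0 K0 S0.
pose eta1 := eta / (q + 1).
have eta10 : 0 < eta1 by rewrite divr_gt0 // ltr_wpDl.
have rad0 : 0 <= `|R1| + `|rad xbar eta1| by rewrite addr_ge0.
have [C2 C20 {}hcrit] := hcrit _ rad0.
exists (C1 + C2); first by rewrite addr_gt0.
move=> alpha sigma b tau tauinf alpha2 [sigM _] hb htau hU [_ hS2] delta w delta0 hw
  /bounded_fun_exists[W bw] [eq2 eq3].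
have diff : diffusion_bounds tau theta L T := tau_std_diffusion htau.
have rev : reverting b binf K := hK _ _ _ hb hU.
have cw : continuous w by case: hw.
have jw y : jet2 w y (grad w y) (hess w y) := jet2_C2 y hw.
pose s y := (sigma xbar y)^T *m pbar.
have sS y : enorm (s y) <= S.
  have sM : `|sigma xbar y| <= `|Msigma| := le_trans (sigM _ _) (ler_norm _).
  by apply: le_trans (enorm_trmx_mul_le _ sM) _; rewrite /S /q mulrAC.
suff one_sided y z : w y - w z <= (C1 + C2) * enorm (y - z).
  move=> y z; rewrite ler_norml one_sided andbT lerNl opprB enormC.
  exact: one_sided.
have e0 := enorm_ge0 (y - z).
move: alpha2; rewrite le_eqVlt => /orP[/eqP alphaE|alpha2].
- have alphaE' : alpha = 2 by [].
  apply: (@le_trans _ _ (C2 * enorm (y - z))); last first.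
    by rewrite ler_wpM2r // lerDr ltW.
  apply: (hcrit tau b s delta w _ _ W diff rev sS _ delta0 cw jw bw).
    move=> y' z' yfar zfar.
    have yR1 : R1 < enorm y'.
      apply: le_lt_trans yfar; have := ler_norm R1; have := normr_ge0 (rad xbar eta1).
      by clear; lra.
    have zR1 : R1 < enorm z'.
      apply: le_lt_trans zfar; have := ler_norm R1; have := normr_ge0 (rad xbar eta1).
      by clear; lra.
    have [by' ty] := hU _ yR1; have [bz tz] := hU _ zR1; split.
    + by rewrite by' bz; apply/matrixP => i j; rewrite !mxE; ring.
    + by rewrite ty tz.
    have [g [g0 gL geta]] := hS2 alphaE' xbar; have [_ {}geta] := geta _ eta10.
    have gy : g y' z' <= eta1.
      apply: geta; [apply: le_trans (ltW yfar)|apply: le_trans (ltW zfar)];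
        have := ler_norm (rad xbar eta1); have := normr_ge0 R1; clear; lra.
    have -> : s y' - s z' = (sigma xbar y' - sigma xbar z')^T *m pbar.
      by rewrite /s linearB mulmxBl.
    apply: le_trans (enorm_trmx_mul_le _ (gL _ _)) _.
    have -> : Num.sqrt (n * m)%:R * (g y' z' * enorm (y' - z')) * enorm pbar =
        g y' z' * q * enorm (y' - z') by rewrite /q; ring.
    rewrite ler_wpM2r ?enorm_ge0 //.
    apply: (@le_trans _ _ (eta1 * (q + 1))); last by rewrite divfK // gt_eqF // ltr_wpDl.
    by rewrite ler_pM // lerDl.
  exact: cell_eq_critical_equation (eq2 alphaE').
- apply: (@le_trans _ _ (C1 * enorm (y - z))); last first.
    by rewrite ler_wpM2r // lerDl ltW.
  apply: (hlin tau b (fun y => enorm (s y) ^+ 2) w _ _ delta W diff rev _ delta0 cw jw bw).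
    move=> y'; apply/andP; split; first exact: sqr_ge0.
    by apply: lerXn2r; rewrite ?nnegrE ?enorm_ge0.
  exact: eq3.
Qed.
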